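(* Let $(A,\{\!\!\{-,-\}\!\!\})$ be a double Poisson algebra over the semisimple algebra $A_0=\oplus_{s\in I}\mathbb{C}e_s$. Assume that $\phi:A\to A$ is an involutive $\mathbb{C}$-linear anti-automorphism with $\phi(e_s)=e_s$ for all $s\in I$ and $(\phi\otimes\phi)(\{\!\!\{a,b\}\!\!\})=\{\!\!\{\phi(a),\phi(b)\}\!\!\}^\circ$ for all $a,b\in A$. For any dimension vector $\alpha\in2\mathbb{N}^I$, $N=\sum_{s\in I}\alpha_s$, considering the involution $\tau:\xi\mapsto\Omega\xi^T\Omega^T$ on $\mathfrak{gl}_N$, the antisymmetric biderivation $\{-,-\}_{\phi,\mathrm{Sp}}$ on $\mathrm{Rep}^{\phi,\tau}(A,\alpha)$ uniquely determined by $$\{a_{ij},b_{kl}\}_{\phi,\mathrm{Sp}}=\tfrac12\{\!\!\{a,b\}\!\!\}_{kj,il}+\tfrac12\,\mathrm{sgn}_\alpha(i,j)\,\{\!\!\{\phi(a),b\}\!\!\}_{k\tau(i),\tau(j)l},\qquad a,b\in A,\ 1\le i,j,k,l\le N,$$ is a Poisson bracket for which the action of $\mathrm{Sp}_\alpha:=\prod_{s\in I}\mathrm{Sp}(\alpha_s)$ is by Poisson automorphisms. Furthermore, if $\mu\in A$ is a moment map (for $\{\!\!\{-,-\}\!\!\}$) chosen to satisfy $\mu+\phi(\mu)=0$, then $\mathtt{X}(\mu):\mathrm{Rep}^{\phi,\tau}(A,\alpha)\to\mathfrak{sp}_\alpha$ is a moment map for $\{-,-\}_{\phi,\mathrm{Sp}}$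 after identifying $\mathfrak{sp}_\alpha=\prod_{s\in I}\mathfrak{sp}(\alpha_s)$ and its dual under the trace pairing.
   Context: Algebras are finitely generated, associative, unital over $\mathbb{C}$; $\otimes=\otimes_{\mathbb{C}}$. $I=\{1,\dots,|I|\}$ is finite, $A_0=\oplus_{s\in I}\mathbb{C}e_s$ with $e_se_t=\delta_{st}e_s$, $\sum_se_s=1$, and $A$ is an algebra over $A_0$. Double brackets. Write $d=d'\otimes d''\in A\otimes A$; $(d'\otimes d'')^\circ=d''\otimes d'$; $a\,d\,b=ad'\otimes d''b$; $a\ast d\ast b=d'b\otimes ad''$. A double bracket is a $\mathbb{C}$-bilinear map $\{\!\!\{-,-\}\!\!\}:A\times A\to A\otimes A$ with $\{\!\!\{a,b\}\!\!\}=-\{\!\!\{b,a\}\!\!\}^\circ$, $\{\!\!\{a,bc\}\!\!\}=\{\!\!\{a,b\}\!\!\}c+b\{\!\!\{a,c\}\!\!\}$, $\{\!\!\{bc,a\}\!\!\}=\{\!\!\{b,a\}\!\!\}\ast c+b\ast\{\!\!\{c,a\}\!\!\}$, and $\{\!\!\{e,a\}\!\!\}=0=\{\!\!\{a,e\}\!\!\}$ for $e\in A_0$. With $\{\!\!\{a,d\}\!\!\}_L=\{\!\!\{a,d'\}\!\!\}\otimes d''$ and $\tau_{(123)}(a_1\otimes a_2\otimes a_3)=a_3\otimes a_1\otimes a_2$, its double Jacobiator is $\{\!\!\{a,b,c\}\!\!\}=\{\!\!\{a,\{\!\!\{b,c\}\!\!\}\}\!\!\}_L+\tau_{(123)}\{\!\!\{b,\{\!\!\{c,a\}\!\!\}\}\!\!\}_L+\tau_{(123)}^2\{\!\!\{c,\{\!\!\{a,b\}\!\!\}\}\!\!\}_L$;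 it is Poisson if this vanishes identically. A moment map is $\mu=\sum_s\mu_s$, $\mu_s\in e_sAe_s$, with $\{\!\!\{\mu_s,a\}\!\!\}=ae_s\otimes e_s-e_s\otimes e_sa$ for all $a\in A$, $s\in I$. Symplectic notation. $\Omega=\mathrm{diag}(\Omega_{\alpha_1},\dots,\Omega_{\alpha_{|I|}})$ with $\Omega_{2d}=\begin{pmatrix}0_d&\mathrm{Id}_d\\-\mathrm{Id}_d&0_d\end{pmatrix}$. $\mathrm{Sp}(\alpha_s)$ preserves $\Omega_{\alpha_s}$. Let $\mathtt{R}_s=\{\alpha_1+\dots+\alpha_{s-1}+1,\dots,\alpha_1+\dots+\alpha_s\}$. For $k\in\mathtt{R}_s$, put $\mathrm{sgn}_\alpha(k)=+1$ if $k$ lies in the first half of $\mathtt{R}_s$ (i.e. $k-\sum_{t<s}\alpha_t\le\alpha_s/2$), $\mathrm{sgn}_\alpha(k)=-1$ otherwise, and $\tau(k)=k+\frac12\mathrm{sgn}_\alpha(k)\alpha_s$. Put $\mathrm{sgn}_\alpha(i,j)=\mathrm{sgn}_\alpha(i)\,\mathrm{sgn}_\alpha(j)$. Representation spaces. $\mathrm{Rep}(A,\alpha)$ is the affine scheme whose coordinate ring is generated by $a_{ij}$ ($a\in A$, $1\le i,j\le N$), linear in $a$, with $(ab)_{ij}=\sum_ra_{ir}b_{rj}$ and $(e_s)_{ij}=\delta_{ij}$ if $i,j\in\mathtt{R}_s$, $0$ otherwise; $\mathtt{X}(a)=(a_{ij})$. $\mathrm{Rep}^{\phi,\tau}(A,\alpha)=\{\rho\mid\rho\circ\phi=\tau\circ\rho\}$: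 its coordinate ring is the quotient by the ideal generated by $\phi(a)_{ij}-\mathrm{sgn}_\alpha(i,j)\,a_{\tau(j),\tau(i)}$. Notation $(c\otimes d)_{kj,il}=c_{kj}d_{il}$. $\mathrm{Sp}_\alpha$, embedded block-diagonally in $\mathrm{GL}_N$, acts by $g\cdot\mathtt{X}(a)=g^{-1}\mathtt{X}(a)g$ on coordinate functions, with infinitesimal action $\xi_M(\mathtt{X}(a))=[\mathtt{X}(a),\xi]$. A moment map for a $G$-invariant Poisson bracket on $M$ is a $G$-equivariant morphism $\mu:M\to\mathfrak{g}^*$ with $\{\langle\mu,\xi\rangle,-\}=\xi_M$ for all $\xi\in\mathfrak g$; under the trace pairing, $\langle\mathtt{X}(\mu),\xi\rangle=\mathrm{tr}(\mathtt{X}(\mu)\xi)$. *)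

(* Defs.v *)
From HB Require Import structures.
From mathcomp Require Import all_boot all_order all_algebra.
From mathcomp Require Import finmap boolp reals complex monalg.

Set Implicit Arguments.
Unset Strict Implicit.
Unset Printing Implicit Defensive.

Import GRing.Theory.

Local Open Scope ring_scope.
Local Open Scope quotient_scope.

Section ModuleQuotient.
Variables (K : pzRingType) (M : lmodType K) (S : M -> Prop).

Inductive lin_span : M -> Prop :=
| lin_span_gen x : S x -> lin_span x
| lin_span0 : lin_span 0
| lin_spanD x y : lin_span x -> lin_span y -> lin_span (x + y)
| lin_spanZ c x : lin_span x -> lin_span (c *: x).

Definition in_lin_span : pred M := fun x => `[< lin_span x >].

Fact lin_span_zmod_closed : zmod_closed in_lin_span.
Proof.
split; first exact/asboolP/lin_span0.
move=> x y /asboolP xS /asboolP yS; apply/asboolP.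
by rewrite -scaleN1r; apply/lin_spanD/lin_spanZ.
Qed.
HB.instance Definition _ :=
  GRing.isZmodClosed.Build M in_lin_span lin_span_zmod_closed.

Definition lin_span_pred : zmodClosed M :=
  GRing.ZmodClosed.clone M in_lin_span _.

Definition mod_quot : Type := Quotient.quot lin_span_pred.
HB.instance Definition _ := GRing.Zmodule.on mod_quot.

Fact mod_proj_key : unit. Proof. exact: tt. Qed.
Definition mod_proj : M -> mod_quot :=
  locked_with mod_proj_key (fun x => \pi_(Quotient.quot lin_span_pred) x).
Lemma mod_projE x : mod_proj x = \pi_(Quotient.quot lin_span_pred) x.
Proof. by rewrite /mod_proj locked_withE. Qed.

Definition mod_repr (q : mod_quot) : M :=
  repr (q : Quotient.quot lin_span_pred).

Lemma mod_reprK q : mod_proj (mod_repr q) = q.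
Proof. by rewrite mod_projE; exact: reprK. Qed.

Lemma mod_projP x y : mod_proj x = mod_proj y <-> lin_span (x - y).
Proof.
rewrite !mod_projE; split=> [/eqP|xyS].
  by rewrite -Quotient.idealrBE => /asboolP.
by apply/eqP; rewrite -Quotient.idealrBE; apply/asboolP.
Qed.

Lemma mod_repr_proj x : lin_span (mod_repr (mod_proj x) - x).
Proof. by apply/mod_projP; rewrite mod_reprK. Qed.

Lemma mod_projD x y : mod_proj (x + y) = mod_proj x + mod_proj y.
Proof.
rewrite !mod_projE; exact: (raddfD (\pi_(Quotient.quot lin_span_pred))).
Qed.

Definition mod_scale (c : K) (q : mod_quot) := mod_proj (c *: mod_repr q).

Lemma mod_projZ c x : mod_proj (c *: x) = mod_scale c (mod_proj x).
Proof.
apply/esym/mod_projP; rewrite -scalerBr; exact/lin_spanZ/mod_repr_proj.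
Qed.

Fact mod_scaleA a b q : mod_scale a (mod_scale b q) = mod_scale (a * b) q.
Proof. by rewrite -[q]mod_reprK -!mod_projZ scalerA. Qed.
Fact mod_scale1 : left_id 1 mod_scale.
Proof. by move=> q; rewrite -[q]mod_reprK -!mod_projZ scale1r. Qed.
Fact mod_scaleDr : right_distributive mod_scale +%R.
Proof.
move=> a q r; rewrite -[q]mod_reprK -[r]mod_reprK.
by rewrite -!(mod_projZ, mod_projD) scalerDr.
Qed.
Fact mod_scaleDl q : {morph mod_scale^~ q : a b / a + b}.
Proof.
by move=> a b; rewrite -[q]mod_reprK -!(mod_projZ, mod_projD) scalerDl.
Qed.
HB.instance Definition _ := GRing.Zmodule_isLmodule.Build K mod_quot
  mod_scaleA mod_scale1 mod_scaleDr mod_scaleDl.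

Lemma mod_proj_linear : linear mod_proj.
Proof. by move=> c x y; rewrite mod_projD mod_projZ. Qed.
HB.instance Definition _ :=
  GRing.isLinear.Build K M mod_quot *:%R mod_proj mod_proj_linear.

End ModuleQuotient.

Section RingQuotient.
Variables (R : comPzRingType) (S : R -> Prop).

Inductive ideal_span : R -> Prop :=
| ideal_span_gen x : S x -> ideal_span x
| ideal_span0 : ideal_span 0
| ideal_spanD x y : ideal_span x -> ideal_span y -> ideal_span (x + y)
| ideal_spanM a x : ideal_span x -> ideal_span (a * x).

Definition in_ideal_span : pred R := fun x => `[< ideal_span x >].

Fact ideal_span_zmod_closed : zmod_closed in_ideal_span.
Proof.
split; first exact/asboolP/ideal_span0.
move=> x y /asboolP xS /asboolP yS; apply/asboolP.
by rewrite -[y]mul1r -mulNr; apply/ideal_spanD/ideal_spanM.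
Qed.
HB.instance Definition _ :=
  GRing.isZmodClosed.Build R in_ideal_span ideal_span_zmod_closed.

Definition ideal_span_pred : zmodClosed R :=
  GRing.ZmodClosed.clone R in_ideal_span _.

(* The library's ring quotient requires a proper ideal; here the quotient may
   be the zero ring, as coordinate rings of empty schemes must be allowed. *)
Definition ring_quot : Type := Quotient.quot ideal_span_pred.
HB.instance Definition _ := GRing.Zmodule.on ring_quot.

Fact ring_proj_key : unit. Proof. exact: tt. Qed.
Definition ring_proj : R -> ring_quot :=
  locked_with ring_proj_key (fun x => \pi_(Quotient.quot ideal_span_pred) x).
Lemma ring_projE x : ring_proj x = \pi_(Quotient.quot ideal_span_pred) x.
Proof. by rewrite /ring_proj locked_withE. Qed.

Definition ring_repr (q : ring_quot) : R :=
  repr (q : Quotient.quot ideal_span_pred).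

Lemma ring_reprK q : ring_proj (ring_repr q) = q.
Proof. by rewrite ring_projE; exact: reprK. Qed.

Lemma ring_projP x y : ring_proj x = ring_proj y <-> ideal_span (x - y).
Proof.
rewrite !ring_projE; split=> [/eqP|xyS].
  by rewrite -Quotient.idealrBE => /asboolP.
by apply/eqP; rewrite -Quotient.idealrBE; apply/asboolP.
Qed.

Lemma ring_repr_proj x : ideal_span (ring_repr (ring_proj x) - x).
Proof. by apply/ring_projP; rewrite ring_reprK. Qed.

Lemma ring_projB x y : ring_proj (x - y) = ring_proj x - ring_proj y.
Proof.
rewrite !ring_projE; exact: (raddfB (\pi_(Quotient.quot ideal_span_pred))).
Qed.
HB.instance Definition _ :=
  GRing.isZmodMorphism.Build R ring_quot ring_proj ring_projB.

Definition ring_quot_one : ring_quot :=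
  lift_cst (Quotient.quot ideal_span_pred) 1.
Definition ring_quot_mul : ring_quot -> ring_quot -> ring_quot :=
  lift_op2 (Quotient.quot ideal_span_pred) *%R.

Lemma ring_proj1 : ring_proj 1 = ring_quot_one.
Proof. by rewrite ring_projE; unlock ring_quot_one. Qed.

Lemma ring_projM x y :
  ring_proj (x * y) = ring_quot_mul (ring_proj x) (ring_proj y).
Proof.
transitivity (ring_proj (ring_repr (ring_proj x) * ring_repr (ring_proj y))).
  apply/esym/ring_projP.
  rewrite -[X in X - _](subrK (x * ring_repr (ring_proj y))) -mulrBl -addrA.
  rewrite -mulrBr mulrC.
  by apply: ideal_spanD; apply/ideal_spanM/ring_repr_proj.
by rewrite [LHS]ring_projE; unlock ring_quot_mul.
Qed.

Fact ring_quot_mulA : associative ring_quot_mul.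
Proof.
move=> p q r; rewrite -[p]ring_reprK -[q]ring_reprK -[r]ring_reprK.
by rewrite -!ring_projM mulrA.
Qed.
Fact ring_quot_mulC : commutative ring_quot_mul.
Proof.
move=> p q; rewrite -[p]ring_reprK -[q]ring_reprK -!ring_projM.
by rewrite mulrC.
Qed.
Fact ring_quot_mul1 : left_id ring_quot_one ring_quot_mul.
Proof. by move=> q; rewrite -[q]ring_reprK -ring_proj1 -ring_projM mul1r. Qed.
Fact ring_quot_mulD : left_distributive ring_quot_mul +%R.
Proof.
move=> p q r; rewrite -[p]ring_reprK -[q]ring_reprK -[r]ring_reprK.
by rewrite -raddfD -!ring_projM mulrDl raddfD.
Qed.
HB.instance Definition _ := GRing.Zmodule_isComPzRing.Build ring_quot
  ring_quot_mulA ring_quot_mulC ring_quot_mul1 ring_quot_mulD.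

Fact ring_proj_monoid_morphism : monoid_morphism ring_proj.
Proof. by split=> [|x y]; [exact: ring_proj1|rewrite ring_projM]. Qed.
HB.instance Definition _ := GRing.isMonoidMorphism.Build R ring_quot
  ring_proj ring_proj_monoid_morphism.

End RingQuotient.

Section Tensor.
Variables (K : comNzRingType) (V W : lmodType K).

Definition is_bilinear (U : lmodType K) (f : V -> W -> U) : Prop :=
  (forall w, linear (f^~ w)) /\ (forall v, linear (f v)).

Definition pure (v : V) (w : W) : {malg K[(V * W)%type]} := mkmalgU (v, w) 1.

Inductive bilinear_relation : {malg K[(V * W)%type]} -> Prop :=
| bilinear_relation_l c v v' w : bilinear_relation
    (pure (c *: v + v') w - (c *: pure v w + pure v' w))
| bilinear_relation_r c v w w' : bilinear_relation
    (pure v (c *: w + w') - (c *: pure v w + pure v w')).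

Definition tensor : Type := mod_quot bilinear_relation.
HB.instance Definition _ := GRing.Lmodule.on tensor.

Definition tens (v : V) (w : W) : tensor :=
  mod_proj bilinear_relation (pure v w).

Lemma tens_bilinear : is_bilinear tens.
Proof.
split=> [w c v v'|v c w w']; rewrite /tens -linearP; apply/mod_projP.
  exact/lin_span_gen/bilinear_relation_l.
exact/lin_span_gen/bilinear_relation_r.
Qed.

Definition malg_lift (U : lmodType K) (f : V -> W -> U)
    (x : {malg K[(V * W)%type]}) : U :=
  \sum_(p <- msupp x) x@_p *: f p.1 p.2.

(* The linear map v (x) w |-> f v w, meaningful when f is bilinear
   (tlift_tens and tlift_linear below). *)
Definition tlift (U : lmodType K) (f : V -> W -> U) (x : tensor) : U :=
  malg_lift f (mod_repr x).

Section Lift.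
Variables (U : lmodType K) (f : V -> W -> U).

Lemma malg_liftEw (d : {fset (V * W)%type}) x : (msupp x `<=` d)%fset ->
  malg_lift f x = \sum_(p <- d) x@_p *: f p.1 p.2.
Proof.
move=> le; rewrite /malg_lift (big_fset_incl _ le) => //= p _.
by move/mcoeff_outdom->; rewrite scale0r.
Qed.

Lemma malg_lift_linear : linear (malg_lift f).
Proof.
move=> c x y; set d := (msupp (c *: x + y) `|` msupp x `|` msupp y)%fset.
rewrite !(@malg_liftEw d); try by apply/fsubsetP=> p; rewrite !inE => ->;
  rewrite ?orbT.
rewrite scaler_sumr -big_split; apply: eq_bigr => p _ /=.
by rewrite mcoeffD mcoeffZ scalerDl scalerA.
Qed.

Lemma malg_lift_pure v w : malg_lift f (pure v w) = f v w.
Proof.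
rewrite (malg_liftEw msuppU_le) big_seq_fset1.
by rewrite mcoeffUU scale1r.
Qed.

Hypothesis fB : is_bilinear f.

Lemma malg_lift_relation x :
  lin_span bilinear_relation x -> malg_lift f x = 0.
Proof.
pose g : {linear _ -> _} := HB.pack (malg_lift f)
  (GRing.isLinear.Build _ _ _ _ (malg_lift f) malg_lift_linear).
have gpure v w : g (pure v w) = f v w by exact: malg_lift_pure.
have -> : malg_lift f = g by [].
elim=> {x} [x xr||x y _ gx _ gy|c x _ gx].
- by case: x / xr => *; rewrite linearB linearP !gpure ?fB.1 ?fB.2 subrr.
- exact: linear0.
- by rewrite linearD gx gy addr0.
- by rewrite linearZ_LR gx scaler0.
Qed.

Lemma tlift_proj x : tlift f (mod_proj bilinear_relation x) = malg_lift f x.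
Proof.
apply/eqP; rewrite -subr_eq0; apply/eqP.
pose g : {linear _ -> _} := HB.pack (malg_lift f)
  (GRing.isLinear.Build _ _ _ _ (malg_lift f) malg_lift_linear).
rewrite /tlift -[malg_lift f]/(g : _ -> _) -linearB.
exact/malg_lift_relation/mod_repr_proj.
Qed.

Lemma tlift_tens v w : tlift f (tens v w) = f v w.
Proof. by rewrite tlift_proj malg_lift_pure. Qed.

Lemma tlift_linear : linear (tlift f).
Proof.
move=> c x y; rewrite -[x]mod_reprK -[y]mod_reprK -linearP !tlift_proj.
exact: malg_lift_linear.
Qed.

End Lift.
End Tensor.

Section DoubleBrackets.
Variables (K : fieldType) (A : algType K).

Definition finitely_generated : Prop :=
  exists gens : seq A, forall P : A -> Prop,
    (forall a, a \in gens -> P a) -> P 1 ->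
    (forall c a, P a -> P (c *: a)) ->
    (forall a b, P a -> P b -> P (a + b)) ->
    (forall a b, P a -> P b -> P (a * b)) ->
    forall a, P a.

(* A ring morphism from the sum of n copies of K to A. *)
Definition orthogonal_idempotents (n : nat) (e : 'I_n -> A) : Prop :=
  (forall s t, e s * e t = if s == t then e s else 0) /\ \sum_s e s = 1.

Local Notation AA := (tensor A A).
Local Notation AAA := (tensor AA A).

Definition tswap (d : AA) : AA := tlift (fun d1 d2 => tens d2 d1) d.
Definition outer (a : A) (d : AA) (b : A) : AA :=
  tlift (fun d1 d2 => tens (a * d1) (d2 * b)) d.
Definition inner (a : A) (d : AA) (b : A) : AA :=
  tlift (fun d1 d2 => tens (d1 * b) (a * d2)) d.
Definition tmap (f : A -> A) (d : AA) : AA :=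
  tlift (fun d1 d2 => tens (f d1) (f d2)) d.
Definition tau123 (t : AAA) : AAA :=
  tlift (fun d a3 => tlift (fun a1 a2 => tens (tens a3 a1) a2) d) t.

Section Bracket.
Variables (n : nat) (e : 'I_n -> A) (dbr : A -> A -> AA).

Definition double_bracket : Prop :=
  [/\ is_bilinear dbr,
      forall a b, dbr a b = - tswap (dbr b a),
      forall a b c, dbr a (b * c) = outer 1 (dbr a b) c + outer b (dbr a c) 1,
      forall a b c, dbr (b * c) a = inner 1 (dbr b a) c + inner b (dbr c a) 1
    & forall (c : 'I_n -> K) a,
        dbr (\sum_s c s *: e s) a = 0 /\ dbr a (\sum_s c s *: e s) = 0].

Definition dbrL (a : A) (d : AA) : AAA :=
  tlift (fun d1 d2 => tens (dbr a d1) d2) d.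

Definition double_jacobiator (a b c : A) : AAA :=
  dbrL a (dbr b c) + tau123 (dbrL b (dbr c a))
    + tau123 (tau123 (dbrL c (dbr a b))).

Definition double_poisson : Prop :=
  double_bracket /\ forall a b c, double_jacobiator a b c = 0.

Definition is_double_moment_map (mu : A) : Prop :=
  exists mus : 'I_n -> A,
    [/\ mu = \sum_s mus s,
        forall s, exists y, mus s = e s * y * e s
      & forall s a,
          dbr (mus s) a = tens (a * e s) (e s) - tens (e s) (e s * a)].

End Bracket.
End DoubleBrackets.

Section SymplecticIndices.
Variables (n : nat) (alpha : 'I_n -> nat).
Local Notation N := (\sum_s alpha s)%N.

(* Indices are numbered from 0: tagnat.sig1 k is the s such that k lies in the
   block R_s, and tagnat.sig2 k is the position of k in that block. *)
Definition first_half (k : 'I_N) : bool :=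
  (tagnat.sig2 k < (alpha (tagnat.sig1 k))./2)%N.

Definition sgn (R : pzRingType) (k : 'I_N) : R :=
  if first_half k then 1 else -1.

Fact half_swap_proof m (p : 'I_m) :
  ((if p < m./2 then p + m./2 else p - m./2) < m)%N.
Proof.
case: (ltnP p m./2) => [lt_p|_]; last exact: leq_ltn_trans (leq_subr _ _) (ltn_ord p).
apply: leq_trans (_ : m./2 + m./2 <= m)%N; first by rewrite ltn_add2r.
by rewrite addnn -[leqRHS]odd_double_half leq_addl.
Qed.
Definition half_swap m (p : 'I_m) : 'I_m := Ordinal (half_swap_proof p).

Definition tau (k : 'I_N) : 'I_N :=
  tagnat.Rank (tagnat.sig1 k) (half_swap (tagnat.sig2 k)).

Lemma val_tau k : tau k = (if first_half k then k + (alpha (tagnat.sig1 k))./2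
                           else k - (alpha (tagnat.sig1 k))./2)%N :> nat.
Proof.
rewrite /tau tagnat.RankEsum /= /first_half.
case: (ltnP (tagnat.sig2 k)) => [_|le_k].
  by rewrite [X in _ = (X + _)%N]tagnat.rect addnA.
by rewrite [X in _ = (X - _)%N]tagnat.rect addnBA.
Qed.

Variable R : pzRingType.

Definition Omega (m : nat) : 'M[R]_m :=
  \matrix_(i, j) (if j == (i + m./2)%N :> nat then 1
                  else if i == (j + m./2)%N :> nat then -1 else 0).

Definition block_Omega : 'M[R]_N := \mxdiag_s Omega (alpha s).

Definition Sp_group (g : 'M[R]_N) : Prop :=
  exists2 h : (forall s, 'M[R]_(alpha s)),
    forall s, (h s)^T *m Omega (alpha s) *m h s = Omega (alpha s)
    & g = \mxdiag_s h s.

Definition sp_algebra (x : 'M[R]_N) : Prop :=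
  exists2 y : (forall s, 'M[R]_(alpha s)),
    forall s, (y s)^T *m Omega (alpha s) + Omega (alpha s) *m y s = 0
    & x = \mxdiag_s y s.

End SymplecticIndices.

Section OmegaInvolution.
Variables (n : nat) (alpha : 'I_n -> nat) (R : comPzRingType).
Local Notation N := (\sum_s alpha s)%N.
Hypothesis alpha_even : forall s, ~~ odd (alpha s).

Lemma sig_val_inj (i j : 'I_N) : tagnat.sig1 i = tagnat.sig1 j ->
  tagnat.sig2 i = tagnat.sig2 j :> nat -> i = j.
Proof.
move=> e1 e2; rewrite -(tagnat.sig2K i) -(tagnat.sig2K j); apply: val_inj.
by apply/eqP; rewrite tagnat.eq_Rank; apply/andP; split; apply/eqP.
Qed.

Lemma sig1_tau (i : 'I_N) : tagnat.sig1 (tau i) = tagnat.sig1 i.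
Proof. by rewrite /tau tagnat.Rank1K. Qed.

Lemma sig2_tau (i : 'I_N) : tagnat.sig2 (tau i) = half_swap (tagnat.sig2 i) :> nat.
Proof. by rewrite /tau tagnat.Rank2K. Qed.

Lemma block_OmegaE (i j : 'I_N) :
  block_Omega alpha R i j = if j == tau i then sgn R i else 0.
Proof.
rewrite /block_Omega /mxdiag !mxE.
have [ij|ij] := eqVneq (tagnat.sig1 i) (tagnat.sig1 j); last first.
  rewrite mxE; case: eqP => // jt; case/eqP: ij.
  by rewrite jt sig1_tau.
have -> : conform_mx (0 : 'M[R]_(alpha (tagnat.sig1 i), alpha (tagnat.sig1 j)))
   (Omega R (alpha (tagnat.sig1 i))) (tagnat.sig2 i) (tagnat.sig2 j) =
   if tagnat.sig2 j == (tagnat.sig2 i + (alpha (tagnat.sig1 i))./2)%N :> nat then 1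
   else if tagnat.sig2 i == (tagnat.sig2 j + (alpha (tagnat.sig1 i))./2)%N :> nat
        then -1 else 0.
  move: (tagnat.sig2 i) (tagnat.sig2 j); rewrite -ij => p q.
  by rewrite conform_mx_id mxE.
have -> : (j == tau i) = (tagnat.sig2 j == half_swap (tagnat.sig2 i) :> nat).
  apply/eqP/eqP => [->|e2]; first exact: sig2_tau.
  by apply: sig_val_inj; rewrite ?sig1_tau ?sig2_tau.
rewrite /sgn /first_half /=.
have ltj : (tagnat.sig2 j < alpha (tagnat.sig1 i))%N.
  by rewrite ij ltn_ord.
have := ltn_ord (tagnat.sig2 i); move: ltj.
move: (nat_of_ord (tagnat.sig2 i)) (nat_of_ord (tagnat.sig2 j)).
have := even_halfK (alpha_even (tagnat.sig1 i)); rewrite -addnn.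
move: ((alpha (tagnat.sig1 i))./2) => d <- p q ltq ltp.
case: (ltnP p d) => [ltpd|ledp].
  case: (q =P (p + d)%N) => // _; case: (p =P (q + d)%N) => // ep.
  by rewrite ep ltnNge leq_addl in ltpd.
case: (q =P (p + d)%N) => [eq|_]; first by rewrite eq ltn_add2r ltnNge ledp in ltq.
suff -> : (q == p - d)%N = (p == q + d)%N by [].
by rewrite -[LHS](eqn_add2r d) subnK // eq_sym.
Qed.

Lemma Omega_involution (x : 'M[R]_N) i j :
  (block_Omega alpha R *m x^T *m (block_Omega alpha R)^T) i j =
    sgn R i * sgn R j * x (tau j) (tau i).
Proof.
have trE (y : 'M[R]_N) k l : y^T k l = y l k by rewrite mxE.
rewrite mxE (bigD1 (tau j)) //= [X in _ + X]big1 => [|k kj]; last first.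
  by rewrite trE block_OmegaE (negPf kj) mulr0.
rewrite trE block_OmegaE eqxx addr0 mxE (bigD1 (tau i)) //= [X in _ + X]big1 => [|k ki].
  by rewrite block_OmegaE eqxx addr0 trE mulrAC.
by rewrite block_OmegaE (negPf ki) mul0r.
Qed.
End OmegaInvolution.

Section RepresentationSpaces.
Variables (K : fieldType) (A : algType K) (n : nat) (e : 'I_n -> A).
Variables (alpha : 'I_n -> nat) (phi : A -> A).
Local Notation N := (\sum_s alpha s)%N.

Local Notation freeRep := {malg K[{cmonom (A * 'I_N * 'I_N)%type}]}.

(* Sealed, like rep_cst below: conversion on elements of the free commutative
   algebra is otherwise very slow. *)
Fact rep_gen_key : unit. Proof. exact: tt. Qed.
Definition rep_gen : A -> 'I_N -> 'I_N -> freeRep :=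
  locked_with rep_gen_key (fun a i j => mkmalgU (ucm (a, i, j)) 1).
Lemma rep_genE a i j : rep_gen a i j = mkmalgU (ucm (a, i, j)) 1.
Proof. by rewrite /rep_gen locked_withE. Qed.

Inductive rep_relation : freeRep -> Prop :=
| rep_relation_linear c a b i j : rep_relation
    (rep_gen (c *: a + b) i j - (c *: rep_gen a i j + rep_gen b i j))
| rep_relation_mul a b i j : rep_relation
    (rep_gen (a * b) i j - \sum_r rep_gen a i r * rep_gen b r j)
| rep_relation_idem s i j : rep_relation
    (rep_gen (e s) i j - if (i == j) && (tagnat.sig1 i == s) then 1 else 0).

(* The coordinate ring of Rep(A, alpha). *)
Definition rep_ring : Type := ring_quot rep_relation.
HB.instance Definition _ := GRing.ComPzRing.on rep_ring.

Definition rep_coord (a : A) (i j : 'I_N) : rep_ring :=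
  ring_proj rep_relation (rep_gen a i j).

Inductive symrep_relation : rep_ring -> Prop :=
| symrep_relation_phi a i j : symrep_relation
    (rep_coord (phi a) i j
       - sgn rep_ring i * sgn rep_ring j * rep_coord a (tau j) (tau i)).

(* The coordinate ring of Rep^{phi,tau}(A, alpha). *)
Definition symrep_ring : Type := ring_quot symrep_relation.
HB.instance Definition _ := GRing.ComPzRing.on symrep_ring.

Local Notation Q := symrep_ring.

Definition symrep_coord (a : A) (i j : 'I_N) : Q :=
  ring_proj symrep_relation (rep_coord a i j).

Fact rep_cst_key : unit. Proof. exact: tt. Qed.
Definition rep_cst : K -> rep_ring :=
  locked_with rep_cst_key (fun c => ring_proj rep_relation (in_alg freeRep c)).
Lemma rep_cstE c : rep_cst c = ring_proj rep_relation c%:A.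
Proof. by rewrite /rep_cst locked_withE. Qed.
Fact rep_cst_zmod_morphism : zmod_morphism rep_cst.
Proof. by move=> b c; rewrite /rep_cst locked_withE rmorphB raddfB. Qed.
Fact rep_cst_monoid_morphism : monoid_morphism rep_cst.
Proof.
by split=> [|b c]; rewrite /rep_cst locked_withE ?rmorph1 // rmorphM [LHS]rmorphM.
Qed.
HB.instance Definition _ :=
  GRing.isZmodMorphism.Build K rep_ring rep_cst rep_cst_zmod_morphism.
HB.instance Definition _ :=
  GRing.isMonoidMorphism.Build K rep_ring rep_cst rep_cst_monoid_morphism.

Definition symrep_cst (c : K) : Q := ring_proj symrep_relation (rep_cst c).
Fact symrep_cst_zmod_morphism : zmod_morphism symrep_cst.
Proof. by move=> b c; rewrite /symrep_cst rmorphB raddfB. Qed.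
Fact symrep_cst_monoid_morphism : monoid_morphism symrep_cst.
Proof. by split=> [|b c]; rewrite /symrep_cst ?rmorph1 // !rmorphM. Qed.
HB.instance Definition _ :=
  GRing.isZmodMorphism.Build K Q symrep_cst symrep_cst_zmod_morphism.
HB.instance Definition _ :=
  GRing.isMonoidMorphism.Build K Q symrep_cst symrep_cst_monoid_morphism.

Fact symrep_scaleA b c (x : Q) :
  symrep_cst b * (symrep_cst c * x) = symrep_cst (b * c) * x.
Proof. by rewrite mulrA (rmorphM symrep_cst). Qed.
Fact symrep_scale1 : left_id 1 (fun c (x : Q) => symrep_cst c * x).
Proof. by move=> x; rewrite (rmorph1 symrep_cst) mul1r. Qed.
Fact symrep_scaleDr :
  right_distributive (fun c (x : Q) => symrep_cst c * x) +%R.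
Proof. by move=> c x y; rewrite mulrDr. Qed.
Fact symrep_scaleDl (x : Q) :
  {morph (fun c => symrep_cst c * x) : b c / b + c}.
Proof. by move=> b c; rewrite (rmorphD symrep_cst) mulrDl. Qed.
HB.instance Definition _ := GRing.Zmodule_isLmodule.Build K symrep_ring
  symrep_scaleA symrep_scale1 symrep_scaleDr symrep_scaleDl.

Definition mx_coord (a : A) : 'M[Q]_N := \matrix_(i, j) symrep_coord a i j.

(* d1 (x) d2 |-> (d1 (x) d2)_{uv,wz} := (d1)_{uv} (d2)_{wz} *)
Definition tensor_coord (d : tensor A A) (u v w z : 'I_N) : Q :=
  tlift (fun d1 d2 => symrep_coord d1 u v * symrep_coord d2 w z) d.

Definition cst_mx (g : 'M[K]_N) : 'M[Q]_N := map_mx symrep_cst g.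

Definition is_derivation (D : Q -> Q) : Prop :=
  linear D /\ forall x y, D (x * y) = D x * y + x * D y.

Definition antisymmetric_biderivation (br : Q -> Q -> Q) : Prop :=
  (forall x y, br x y = - br y x) /\ forall x, is_derivation (br x).

Definition poisson_bracket (br : Q -> Q -> Q) : Prop :=
  antisymmetric_biderivation br /\
  forall x y z, br x (br y z) + br y (br z x) + br z (br x y) = 0.

Definition phi_Sp_formula (dbr : A -> A -> tensor A A) (br : Q -> Q -> Q) :=
  forall a b (i j k l : 'I_N),
    br (symrep_coord a i j) (symrep_coord b k l) =
      2%:R^-1 *: tensor_coord (dbr a b) k j i l
      + (2%:R^-1 * (sgn K i * sgn K j)) *:
          tensor_coord (dbr (phi a) b) k (tau i) (tau j) l.

Definition is_Sp_action (act : 'M[K]_N -> Q -> Q) : Prop :=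
  [/\ forall g, Sp_group g -> linear (act g) /\ monoid_morphism (act g),
      forall x, act 1%:M x = x,
      forall g h, Sp_group g -> Sp_group h ->
        forall x, act (g *m h) x = act g (act h x)
    & forall g, Sp_group g -> forall a,
        map_mx (act g) (mx_coord a) =
          cst_mx (invmx g) *m mx_coord a *m cst_mx g].

Definition is_infinitesimal_action (inf : 'M[K]_N -> Q -> Q) : Prop :=
  forall xi, sp_algebra xi ->
    is_derivation (inf xi) /\
    forall a, map_mx (inf xi) (mx_coord a) =
      mx_coord a *m cst_mx xi - cst_mx xi *m mx_coord a.

(* A morphism m from Rep^{phi,tau}(A, alpha) to the dual of sp_alpha is given by
   the functions <m, xi>; with (g . f)(x) = f (g^-1 . x), its equivariance for
   the coadjoint action reads g . <m, xi> = <m, g xi g^-1>. *)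
Definition is_moment_map (br : Q -> Q -> Q) (act inf : 'M[K]_N -> Q -> Q)
    (m : 'M[K]_N -> Q) : Prop :=
  [/\ forall c xi zeta, sp_algebra xi -> sp_algebra zeta ->
        m (c *: xi + zeta) = c *: m xi + m zeta,
      forall g xi, Sp_group g -> sp_algebra xi ->
        act g (m xi) = m (g *m xi *m invmx g)
    & forall xi, sp_algebra xi -> forall f, br (m xi) f = inf xi f].

Definition trace_pairing (x : 'M[Q]_N) (xi : 'M[K]_N) : Q :=
  \tr (x *m cst_mx xi).

Section Coordinates.
Local Notation X := mx_coord.
Local Notation coord := symrep_coord.

Lemma symrep_scaleE c (x : Q) : c *: x = symrep_cst c * x.
Proof. by []. Qed.

Lemma coord_linear i j : linear (fun a => coord a i j).
Proof.
move=> c a b; rewrite symrep_scaleE /symrep_coord /symrep_cst -rmorphM -rmorphD.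
congr (ring_proj _ _); rewrite /rep_coord rep_cstE -rmorphM -rmorphD.
apply/ring_projP; rewrite mulr_algl; exact/ideal_span_gen/rep_relation_linear.
Qed.

Lemma mx_coordM a b : X (a * b) = X a *m X b.
Proof.
apply/matrixP=> i j; rewrite !mxE.
under [RHS]eq_bigr do rewrite !mxE /symrep_coord -rmorphM.
rewrite -rmorph_sum /symrep_coord; congr (ring_proj _ _).
under [RHS]eq_bigr do rewrite -rmorphM.
rewrite -rmorph_sum; apply/ring_projP.
exact/ideal_span_gen/rep_relation_mul.
Qed.

Lemma mx_coord_idem s : X (e s) =
  \matrix_(i, j) if (i == j) && (tagnat.sig1 i == s) then 1 else 0.
Proof.
apply/matrixP=> i j; rewrite !mxE /symrep_coord.
have -> : rep_coord (e s) i j =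
   if (i == j) && (tagnat.sig1 i == s) then 1 else 0.
  rewrite [RHS](_ : _ = ring_proj rep_relation
     (if (i == j) && (tagnat.sig1 i == s) then 1 else 0)).
    by apply/ring_projP/ideal_span_gen/rep_relation_idem.
  by case: ifP; rewrite ?rmorph1 ?rmorph0.
by case: ifP; rewrite ?rmorph1 ?rmorph0.
Qed.

Lemma coord_phi a i j :
  coord (phi a) i j = sgn Q i * sgn Q j * coord a (tau j) (tau i).
Proof.
rewrite /symrep_coord (_ : sgn Q i * sgn Q j = ring_proj symrep_relation
  (sgn rep_ring i * sgn rep_ring j)).
  rewrite -rmorphM; apply/ring_projP; exact/ideal_span_gen/symrep_relation_phi.
by rewrite rmorphM /sgn; do 2!case: ifP; rewrite ?rmorphN ?rmorph1.
Qed.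

Lemma mx_coord_phi : (forall s, ~~ odd (alpha s)) -> forall a,
  X (phi a) = block_Omega alpha Q *m (X a)^T *m (block_Omega alpha Q)^T.
Proof.
move=> ev a; apply/matrixP=> i j.
by rewrite (Omega_involution ev) !mxE coord_phi.
Qed.
End Coordinates.

End RepresentationSpaces.

(* Main.v *)
(** The involution theta : a_ij |-> sgn(i,j) phi(a)_{tau(j),tau(i)} of Rep(A, alpha)
    preserves Van den Bergh's Poisson bracket {a_ij, b_kl} = {{a,b}}_{kj,il}, and
    Rep^{phi,tau}(A, alpha) is its fixed locus, cut out by the ideal of all
    x - theta(x). For theta-invariant x the derivation {x, -} commutes with theta,
    hence preserves that ideal, and {(x + theta(x))/2, y} modulo the ideal is the
    required bracket of the classes of x and y: it depends only on these classes, and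
    it inherits the Jacobi identity because it is the class of the bracket of the
    invariant representatives. The symplectic group and its Lie algebra commute with
    theta, and tr(X(mu) xi) is theta-invariant when mu + phi(mu) = 0, so that
    invariance and the moment map property also descend from Rep(A, alpha). *)

Require Import Defs.
From HB Require Import structures.
From mathcomp Require Import all_boot all_order all_algebra.
From mathcomp Require Import finmap boolp reals complex monalg.

Set Implicit Arguments.
Unset Strict Implicit.
Unset Printing Implicit Defensive.

Import GRing.Theory.
Local Open Scope ring_scope.

(** * Representation rings and their derivations *)

(** Origin of the formula: its second term is half the bracket of [th (a_ij)] with [b_kl], so both
    factors 1/2 come from averaging over the group of order two generated by [th]. Only the left
    argument is averaged; antisymmetry, and with it independence of the left representative,
    therefore holds only modulo the ideal, after the right argument has been replaced by its own
    average, which has the same class. What shapes the development is that both coordinate rings are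
    quotients given by generators and relations. Every morphism, derivation and biderivation must be
    built from values on the coordinates that respect the relations of A, and every identity must be
    reduced to coordinates: an identity of derivations is checked on generators, and the Jacobi
    identity is handled one argument at a time. The involution, the group action and the
    infinitesimal action are all prescribed by what they do to the matrix X(a), so that their
    compatibility becomes a computation with the adjoint of matrices with respect to Omega. *)

Section FreeAlgebraEvaluation.
Variables (K : nzRingType) (I : choiceType) (S : comPzRingType).
Variables (c : {rmorphism K -> S}) (v : I -> S).

Definition monom_eval (m : {cmonom I}) : S := \prod_(x <- finsupp m) v x ^+ m x.

Lemma monom_evalEw (m : {cmonom I}) (d : {fset I}) : (finsupp m `<=` d)%fset ->
  monom_eval m = \prod_(x <- d) v x ^+ m x.
Proof.
move=> le; rewrite /monom_eval (big_fset_incl _ le) //= => x _.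
by rewrite -cmE_eq0 => /eqP->; rewrite expr0.
Qed.

Lemma monom_eval1 : monom_eval mone = 1.
Proof. by rewrite /monom_eval mdom1 big_seq_fset0. Qed.

Lemma monom_evalM m1 m2 :
  monom_eval (mmul m1 m2) = monom_eval m1 * monom_eval m2.
Proof.
rewrite {1}/monom_eval mdomD.
rewrite (monom_evalEw (fsubsetUl _ (finsupp m2))).
rewrite (monom_evalEw (fsubsetUr (finsupp m1) _)) -big_split /=.
by apply: eq_bigr => x _; rewrite cmM exprD.
Qed.

Lemma monom_evalU x : monom_eval (ucm x) = v x.
Proof. by rewrite /monom_eval mdomU big_seq_fset1 cmUU expr1. Qed.

(** The universal property of polynomial rings. The target may be the zero ring, since a
    representation space may be empty. *)
Definition malg_eval (p : {malg K[{cmonom I}]}) : S :=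
  \sum_(m <- msupp p) c p@_m * monom_eval m.

Lemma malg_evalEw (d : {fset {cmonom I}}) p : (msupp p `<=` d)%fset ->
  malg_eval p = \sum_(m <- d) c p@_m * monom_eval m.
Proof.
move=> le; rewrite /malg_eval (big_fset_incl _ le) //= => x _.
by move/mcoeff_outdom->; rewrite raddf0 mul0r.
Qed.

Fact malg_eval_zmod_morphism : zmod_morphism malg_eval.
Proof.
move=> p q; set d := (msupp (p - q) `|` msupp p `|` msupp q)%fset.
rewrite !(@malg_evalEw d); try by apply/fsubsetP=> m; rewrite !inE => ->;
  rewrite ?orbT.
by rewrite -sumrB; apply: eq_bigr => m _; rewrite !raddfB /= mulrBl.
Qed.
HB.instance Definition _ := GRing.isZmodMorphism.Build _ _ malg_eval
  malg_eval_zmod_morphism.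

Lemma malg_evalU k m : malg_eval (mkmalgU m k) = c k * monom_eval m.
Proof. by rewrite (malg_evalEw msuppU_le) big_seq_fset1 mcoeffUU. Qed.

Fact malg_eval_monoid_morphism : monoid_morphism malg_eval.
Proof.
split=> [|p q].
  by have := malg_evalU 1 mone; rewrite rmorph1 mul1r monom_eval1.
rewrite malgME raddf_sum mulr_suml /=; apply: eq_bigr => i _.
rewrite raddf_sum mulr_sumr /=; apply: eq_bigr => j _.
by rewrite malg_evalU rmorphM monom_evalM mulrACA.
Qed.
HB.instance Definition _ := GRing.isMonoidMorphism.Build _ _ malg_eval
  malg_eval_monoid_morphism.

Lemma malg_evalZ k p : malg_eval (k *: p) = c k * malg_eval p.
Proof.
by rewrite -mul_malgC rmorphM /= malg_evalU monom_eval1 mulr1.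
Qed.

End FreeAlgebraEvaluation.

Lemma malgU_scale (K : nzRingType) (I : choiceType) (m : I) (k : K) :
  mkmalgU m k = k *: mkmalgU m 1 :> {malg K[I]}.
Proof. by apply/malgP=> m'; rewrite mcoeffZ !mcoeffU mulr_natr. Qed.

(** Polynomials are generated by constants and variables; this is what makes the coordinate rings
    generated by the [a_ij]. *)
Lemma malg_cmonom_ind (K : nzRingType) (I : choiceType)
    (P : {malg K[{cmonom I}]} -> Prop) :
    (forall k, P (k *: 1)) -> (forall x, P (mkmalgU (ucm x) 1)) ->
    (forall p q, P p -> P q -> P (p + q)) ->
    (forall p q, P p -> P q -> P (p * q)) ->
  forall p, P p.
Proof.
move=> PC PU PD PM p.
have UM (m1 m2 : {cmonom I}) : mkmalgU (mmul m1 m2) 1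
    = mkmalgU m1 1 * mkmalgU m2 1 :> {malg K[{cmonom I}]}.
  by rewrite [RHS]fgmulUU mulr1.
have UZ (m : {cmonom I}) k :
    mkmalgU m k = k *: 1 * mkmalgU m 1 :> {malg K[{cmonom I}]}.
  by rewrite -scalerAl mul1r; exact: malgU_scale.
have P1 : P 1 by rewrite -[1]scale1r.
have PX (m : {cmonom I}) : P (mkmalgU m 1).
  (* Induction on a bound for the degree: a nontrivial monomial loses one variable [x] of its
     support at each step. *)
  move: {2}(mdeg m).+1 (ltnSn (mdeg m)) => d.
  elim: d m => [|d IHd] m lt_m; first by exfalso; rewrite ltn0 in lt_m.
  have [/eqP m0|m_neq0] := boolP (mdeg m == 0%N).
    by rewrite (mdeg_eq0I m0); exact: P1.
  have [x xm] : exists x, x \in finsupp m.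
    apply: contrapT => nom; case/eqP: m_neq0.
    by rewrite mdegE big1_seq // => x /andP[_ xm]; case: nom; exists x.
  have def_m : m = mmul (ucm x) (divcm m (ucm x)).
    apply/eqP/cmP=> y; rewrite cmM divcmE cmU subnKC //.
    by case: eqP => // <-; rewrite lt0n cmE_neq0.
  rewrite def_m UM; apply: PM; [exact: PU|apply: IHd].
  by rewrite -ltnS; apply: leq_trans lt_m; rewrite ltnS {2}def_m mdegM mdegU.
rewrite [p]monalgE; elim/big_rec: _ => [|m q _ Pq].
  by rewrite -[0](scale0r 1); exact: PC.
apply: PD; last exact: Pq.
by rewrite UZ; exact: PM (PC _) (PX m).
Qed.

(** * Maps out of a quotient ring *)

Section QuotientMaps.
Variables (R : comPzRingType) (rel : R -> Prop).

(** Only additivity is asked of [F], because it also has to serve for a derivation followed by a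
    projection. Vanishing is therefore required on all multiples of the generators. *)
Lemma ideal_span_le (T : zmodType) (F : R -> T) :
    (forall x y, F (x + y) = F x + F y) ->
    (forall a x, rel x -> F (a * x) = 0) ->
  forall x, ideal_span rel x -> F x = 0.
Proof.
move=> FD Frel.
suff Fa a x : ideal_span rel x -> F (a * x) = 0.
  by move=> x /(Fa 1); rewrite mul1r.
move=> xS; elim: xS a => {x} [x xr a||x y _ IHx _ IHy a|b x _ IHx a].
- exact: Frel.
- by move=> a; rewrite mulr0; apply: (addrI (F 0)); rewrite -FD !addr0.
- by rewrite mulrDr FD IHx IHy addr0.
- by rewrite mulrA IHx.
Qed.

Lemma ring_proj_surj (q : ring_quot rel) : exists x, q = ring_proj rel x.
Proof. by exists (ring_repr q); rewrite ring_reprK. Qed.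

Lemma ring_quot_map (T : zmodType) (F : R -> T) :
    (forall x y, F (x + y) = F x + F y) ->
    (forall a x, rel x -> F (a * x) = 0) ->
  forall x, F (ring_repr (ring_proj rel x)) = F x.
Proof.
move=> FD Frel x; rewrite -[in LHS](subrK x (ring_repr _)) FD.
by rewrite (ideal_span_le FD Frel) ?add0r //; exact: ring_repr_proj.
Qed.

Lemma ring_quot_rmorphism (T : comPzRingType) (F : {rmorphism R -> T}) :
    (forall x, rel x -> F x = 0) ->
  {G : {rmorphism ring_quot rel -> T} | forall x, G (ring_proj rel x) = F x}.
Proof.
move=> Frel; have GE x : F (ring_repr (ring_proj rel x)) = F x.
  apply: ring_quot_map; first exact: rmorphD.
  by move=> a y /Frel; rewrite rmorphM => ->; rewrite mulr0.
pose G (q : ring_quot rel) := F (ring_repr q).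
have GB : zmod_morphism G.
  move=> p q; have [[x ->] [y ->]] := (ring_proj_surj p, ring_proj_surj q).
  by rewrite -rmorphB /G !GE rmorphB.
have GM : monoid_morphism G.
  split=> [|p q]; first by rewrite -(rmorph1 (ring_proj rel)) /G GE rmorph1.
  have [[x ->] [y ->]] := (ring_proj_surj p, ring_proj_surj q).
  by rewrite -rmorphM /G !GE rmorphM.
pose g : {rmorphism ring_quot rel -> T} := HB.pack G
  (GRing.isZmodMorphism.Build _ _ G GB) (GRing.isMonoidMorphism.Build _ _ G GM).
by exists g.
Qed.

End QuotientMaps.

(** * Dual numbers and derivations *)

Section DualNumbers.
Variable S : comPzRingType.

(* [(x, y)] stands for [x + y eps] with [eps ^ 2 = 0]; the ring morphisms into dual
   numbers that lift the identity are the derivations. *)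
Definition dual_number : Type := (S * S)%type.
HB.instance Definition _ := GRing.Zmodule.on dual_number.

Definition dual_mul (x y : dual_number) : dual_number :=
  (x.1 * y.1, x.1 * y.2 + x.2 * y.1).

Fact dual_mulA : associative dual_mul.
Proof.
move=> [x x'] [y y'] [z z']; rewrite /dual_mul /= mulrA; congr pair.
by rewrite mulrDr mulrDl !mulrA addrA.
Qed.
Fact dual_mulC : commutative dual_mul.
Proof.
move=> [x x'] [y y']; rewrite /dual_mul /= mulrC; congr pair.
by rewrite addrC mulrC [x * _]mulrC.
Qed.
Fact dual_mul1 : left_id (1, 0) dual_mul.
Proof. by move=> [x x']; rewrite /dual_mul /= !mul1r mul0r addr0. Qed.
Fact dual_mulD : left_distributive dual_mul +%R.
Proof.
move=> [x x'] [y y'] [z z']; rewrite /dual_mul; congr pair => /=.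
  exact: mulrDl.
by rewrite !mulrDl addrACA.
Qed.
HB.instance Definition _ := GRing.Zmodule_isComPzRing.Build dual_number
  dual_mulA dual_mulC dual_mul1 dual_mulD.

Lemma dual_sumE (I : Type) (r : seq I) (F : I -> dual_number) :
  \sum_(i <- r) F i = (\sum_(i <- r) (F i).1, \sum_(i <- r) (F i).2).
Proof. by elim/big_rec3: _ => // i y1 y2 y _ ->. Qed.

End DualNumbers.

Section Derivations.
Variables (K : nzRingType) (B : comPzRingType) (cst : {rmorphism K -> B}).

Definition derivation_over (D : B -> B) : Prop :=
  [/\ forall x y, D (x + y) = D x + D y,
      forall k, D (cst k) = 0
    & forall x y, D (x * y) = D x * y + x * D y].

Lemma derivation_over0 : derivation_over (fun=> 0).
Proof. by split=> *; rewrite ?mul0r ?mulr0 ?addr0. Qed.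

Lemma derivation_overD D D' : derivation_over D -> derivation_over D' ->
  derivation_over (fun x => D x + D' x).
Proof.
move=> [DD DC DM] [D'D D'C D'M]; split=> [x y|k|x y].
- by rewrite DD D'D addrACA.
- by rewrite DC D'C addr0.
- by rewrite DM D'M addrACA -mulrDl -mulrDr.
Qed.

Lemma derivation_overM a D :
  derivation_over D -> derivation_over (fun x => a * D x).
Proof.
move=> [DD DC DM]; split=> [x y|k|x y]; first by rewrite DD mulrDr.
  by rewrite DC mulr0.
by rewrite DM mulrDr mulrA [a * (x * _)]mulrCA.
Qed.

Lemma derivation_overN D :
  derivation_over D -> derivation_over (fun x => - D x).
Proof.
move=> [DD DC DM]; split=> [x y|k|x y]; first by rewrite DD opprD.
  by rewrite DC oppr0.
by rewrite DM opprD mulNr mulrN.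
Qed.

Lemma derivation_over_sum (I : Type) (r : seq I) (D : I -> B -> B) :
    (forall i, derivation_over (D i)) ->
  derivation_over (fun x => \sum_(i <- r) D i x).
Proof.
move=> DD; elim: r => [|i r IHr].
  by under eq_fun do rewrite big_nil; exact: derivation_over0.
by under eq_fun do rewrite big_cons; exact: derivation_overD.
Qed.

Lemma derivation_over_conj (f g : {rmorphism B -> B}) D :
    cancel f g -> (forall k, f (cst k) = cst k) -> derivation_over D ->
  derivation_over (fun x => g (D (f x))).
Proof.
move=> fK fC [DD DC DM]; split=> [x y|k|x y].
- by rewrite rmorphD DD rmorphD.
- by rewrite fC DC rmorph0.
- by rewrite rmorphM DM rmorphD; congr (_ + _); rewrite rmorphM fK.
Qed.

Lemma derivation_over_0 D : derivation_over D -> D 0 = 0.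
Proof. by case=> _ DC _; rewrite -(rmorph0 cst) DC rmorph0. Qed.

Lemma derivation_over_opp D x : derivation_over D -> D (- x) = - D x.
Proof.
move=> DD; apply: (addrI (D x)); case: (DD) => <- _ _.
by rewrite !subrr (derivation_over_0 DD).
Qed.

Lemma derivation_overZ D k x : derivation_over D -> D (cst k * x) = cst k * D x.
Proof. by case=> _ DC DM; rewrite DM DC mul0r add0r. Qed.

Variables (I : Type) (X : I -> B).

(** Generation is phrased as an induction principle, so that it can be fed directly to [elim]. *)
Definition generated_over : Prop := forall P : B -> Prop,
  (forall k, P (cst k)) -> (forall i, P (X i)) ->
  (forall x y, P x -> P y -> P (x + y)) ->
  (forall x y, P x -> P y -> P (x * y)) -> forall x, P x.

Hypothesis Xgen : generated_over.

Lemma derivation_over_ext D D' : derivation_over D -> derivation_over D' ->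
  (forall i, D (X i) = D' (X i)) -> D =1 D'.
Proof.
move=> [DD DC DM] [D'D D'C D'M] eqX; apply: Xgen => [k|//|x y IHx IHy|x y IHx IHy].
- by rewrite DC D'C.
- by rewrite DD D'D IHx IHy.
- by rewrite DM D'M IHx IHy.
Qed.

Lemma rmorphism_ext (T : pzRingType) (f g : {rmorphism B -> T}) :
    (forall k, f (cst k) = g (cst k)) -> (forall i, f (X i) = g (X i)) ->
  f =1 g.
Proof.
move=> eqC eqX; apply: Xgen => // x y IHx IHy.
  by rewrite !rmorphD IHx IHy.
by rewrite !rmorphM IHx IHy.
Qed.

End Derivations.

(** * Maps out of tensor products *)

Section TensorMaps.
Variables (K : comNzRingType) (V W : lmodType K).

(** No case for scalars arises, since a scalar is absorbed by the left factor of a pure tensor. *)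
Lemma tens_ind (P : tensor V W -> Prop) :
    (forall v w, P (tens v w)) -> (forall x y, P x -> P y -> P (x + y)) ->
  forall x, P x.
Proof.
move=> Pt PD x; rewrite -[x]mod_reprK [mod_repr x]monalgE.
have tensZ (c : K) (v : V) (w : W) : c *: tens v w = tens (c *: v) w.
  have tl := (@tens_bilinear K V W).1 w.
  have t0 : tens (0 : V) w = 0.
    by have := tl (-1) 0 0; rewrite scaler0 addr0 scaleN1r addNr.
  by have := tl c v 0; rewrite !addr0 t0 addr0.
elim/big_rec: _ => [|m y _ Py].
  suff <- : tens (0 : V) (0 : W) = mod_proj (@bilinear_relation K V W) 0 by exact: Pt.
  by rewrite raddf0 -(scale0r (0 : V)) -tensZ scale0r.
rewrite mod_projD; apply: PD Py.
have -> : mkmalgU m (mod_repr x)@_m = (mod_repr x)@_m *: pure m.1 m.2.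
  by rewrite [LHS]malgU_scale; case: m.
rewrite (_ : mod_proj _ _ = (mod_repr x)@_m *: tens m.1 m.2); last exact: mod_projZ.
by rewrite tensZ; exact: Pt.
Qed.

Lemma tlift_ext (U : zmodType) (f g : tensor V W -> U) :
    (forall x y, f (x + y) = f x + f y) ->
    (forall x y, g (x + y) = g x + g y) ->
    (forall v w, f (tens v w) = g (tens v w)) ->
  f =1 g.
Proof.
by move=> fD gD fg; apply: tens_ind => // x y IHx IHy; rewrite fD gD IHx IHy.
Qed.

Variables (U : lmodType K) (f : V -> W -> U).
Hypothesis fB : is_bilinear f.

Lemma tliftD x y : tlift f (x + y) = tlift f x + tlift f y.
Proof. by have := tlift_linear fB 1 x y; rewrite !scale1r. Qed.
Lemma tlift0 : tlift f 0 = 0.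
Proof. by apply: (addrI (tlift f 0)); rewrite -tliftD !addr0. Qed.
Lemma tliftN x : tlift f (- x) = - tlift f x.
Proof. by apply: (addrI (tlift f x)); rewrite -tliftD !subrr tlift0. Qed.

End TensorMaps.

(** * Universal property of the coordinate ring *)

Section RepresentationRing.
Variables (K : fieldType) (A : algType K) (n : nat) (e : 'I_n -> A).
Variable alpha : 'I_n -> nat.
Local Notation N := (\sum_s alpha s)%N.
Local Notation B := (rep_ring e alpha).
Local Notation cst := (rep_cst e alpha).
Local Notation X := (@rep_coord K A n e alpha).
Local Notation idem s i j := ((i == j :> 'I_N) && (tagnat.sig1 i == s)).

(** The ring [rep_ring] needs a module structure over [K] to be a target of [tlift]. *)
Fact rep_scaleA b c (x : B) : cst b * (cst c * x) = cst (b * c) * x.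
Proof. by rewrite mulrA rmorphM. Qed.
Fact rep_scale1 : left_id 1 (fun c (x : B) => cst c * x).
Proof. by move=> x; rewrite rmorph1 mul1r. Qed.
Fact rep_scaleDr : right_distributive (fun c (x : B) => cst c * x) +%R.
Proof. by move=> c x y; rewrite mulrDr. Qed.
Fact rep_scaleDl (x : B) : {morph (fun c => cst c * x) : b c / b + c}.
Proof. by move=> b c; rewrite rmorphD mulrDl. Qed.
HB.instance Definition _ := GRing.Zmodule_isLmodule.Build K (rep_ring e alpha)
  rep_scaleA rep_scale1 rep_scaleDr rep_scaleDl.

Lemma rep_scaleE c (x : B) : c *: x = cst c * x. Proof. by []. Qed.

Lemma rep_coord_linear c a b i j : X (c *: a + b) i j = cst c * X a i j + X b i j.
Proof.
rewrite rep_cstE /rep_coord -rmorphM -rmorphD; apply/ring_projP.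
by rewrite mulr_algl; exact/ideal_span_gen/rep_relation_linear.
Qed.

Lemma rep_coordM a b i j : X (a * b) i j = \sum_r X a i r * X b r j.
Proof.
rewrite /rep_coord; under [RHS]eq_bigr do rewrite -rmorphM.
rewrite -rmorph_sum; apply/ring_projP.
exact/ideal_span_gen/rep_relation_mul.
Qed.

Lemma rep_coord_idem s i j : X (e s) i j = if idem s i j then 1 else 0.
Proof.
transitivity (ring_proj (@rep_relation K A n e alpha)
  (if idem s i j then 1 else 0)).
  exact/ring_projP/ideal_span_gen/rep_relation_idem.
by case: ifP; rewrite ?rmorph1 ?rmorph0.
Qed.

Lemma rep_generated :
  generated_over cst (fun t : A * 'I_N * 'I_N => X t.1.1 t.1.2 t.2).
Proof.
move=> P PC PX PD PM x; have [p ->] := ring_proj_surj x.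
elim/malg_cmonom_ind: p => [k|[[a i] j]|p q Pp Pq|p q Pp Pq].
- by rewrite -rep_cstE; exact: PC.
- by rewrite -rep_genE; exact: (PX (a, i, j)).
- by rewrite rmorphD; exact: PD.
- by rewrite rmorphM; exact: PM.
Qed.

Section Lift.
Variables (S : comPzRingType) (c : {rmorphism K -> S}).
Variable f : A -> 'I_N -> 'I_N -> S.
Hypothesis f_linear : forall k a b i j,
  f (k *: a + b) i j = c k * f a i j + f b i j.
Hypothesis fM : forall a b i j, f (a * b) i j = \sum_r f a i r * f b r j.
Hypothesis f_idem : forall s i j, f (e s) i j = if idem s i j then 1 else 0.

(** An [S]-point of Rep(A, alpha) is a matrix representation over [S]. The structure map [c] is left
    free so that [S] can be the dual numbers. *)
Lemma rep_lift : {g : {rmorphism B -> S} |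
  (forall k, g (cst k) = c k) & (forall a i j, g (X a i j) = f a i j)}.
Proof.
pose ev : {rmorphism _ -> S} :=
  @malg_eval K _ S c (fun t : A * 'I_N * 'I_N => f t.1.1 t.1.2 t.2).
have evC k : ev k%:A = c k by rewrite [LHS]malg_evalZ rmorph1 mulr1.
have evX a i j : ev (rep_gen a i j) = f a i j.
  by rewrite rep_genE [LHS]malg_evalU rmorph1 mul1r monom_evalU.
have ev_rel x : rep_relation e x -> ev x = 0.
  case=> [k a b i j|a b i j|s i j].
  - by rewrite !(rmorphB, rmorphD) /= [ev (k *: _)]malg_evalZ !evX f_linear subrr.
  - rewrite rmorphB rmorph_sum /= evX fM.
    by under [X in _ - X]eq_bigr do rewrite rmorphM /= !evX; rewrite subrr.
  - rewrite rmorphB /= evX f_idem.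
    by case: ifP; rewrite ?rmorph1 ?rmorph0 subrr.
have [g gE] := ring_quot_rmorphism ev_rel.
exists g => [k|a i j]; last by rewrite [LHS]gE evX.
by rewrite rep_cstE [LHS]gE evC.
Qed.

End Lift.

Section Derivation.
Variable v : A -> 'I_N -> 'I_N -> B.
Hypothesis v_linear : forall k a b i j,
  v (k *: a + b) i j = cst k * v a i j + v b i j.
Hypothesis vM : forall a b i j,
  v (a * b) i j = \sum_r (v a i r * X b r j + X a i r * v b r j).
Hypothesis v_idem : forall s i j, v (e s) i j = 0.

(** The hypotheses on [v] say exactly that [a_ij + v a i j eps] defines a point over the dual
    numbers; the derivation is the [eps] part of the resulting morphism. *)
Lemma rep_derivation : {D : B -> B | derivation_over cst D &
  forall a i j, D (X a i j) = v a i j}.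
Proof.
pose c k : dual_number B := (cst k, 0).
have cB : zmod_morphism c.
  by move=> x y; rewrite /c rmorphB; congr pair; rewrite subr0.
have cM : monoid_morphism c.
  split=> [|x y]; first by rewrite /c rmorph1.
  by rewrite /c rmorphM; congr pair; rewrite mulr0 mul0r addr0.
pose cr : {rmorphism K -> dual_number B} := HB.pack c
  (GRing.isZmodMorphism.Build _ _ c cB) (GRing.isMonoidMorphism.Build _ _ c cM).
pose f a i j : dual_number B := (X a i j, v a i j).
have [k a b i j|a b i j|s i j|g gC gX] := @rep_lift _ cr f.
- rewrite /f rep_coord_linear v_linear; congr pair => /=.
  by rewrite mul0r addr0.
- rewrite dual_sumE /f /= rep_coordM vM; congr pair.
  by apply: eq_bigr => r _; rewrite addrC.
- by rewrite /f rep_coord_idem v_idem; case: ifP.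
(* The morphism lifts the identity; this turns multiplicativity of [g] into the Leibniz rule for its
   second component. *)
have g1 x : (g x).1 = x.
  elim/rep_generated: x => [k|[[a i] j]|x y IHx IHy|x y IHx IHy].
  - by rewrite gC.
  - by rewrite gX.
  - by rewrite rmorphD /= IHx IHy.
  - by rewrite rmorphM /= IHx IHy.
exists (fun x => (g x).2) => [|a i j]; last by rewrite gX.
split=> [x y|k|x y]; rewrite ?rmorphD ?gC //.
by rewrite rmorphM /= !g1 addrC.
Qed.

End Derivation.

Section Biderivation.
Variable v : A -> 'I_N -> 'I_N -> A -> 'I_N -> 'I_N -> B.
Hypothesis vl_linear : forall k a a' i j b p q,
  v (k *: a + a') i j b p q = cst k * v a i j b p q + v a' i j b p q.
Hypothesis vlM : forall a a' i j b p q, v (a * a') i j b p q =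
  \sum_r (v a i r b p q * X a' r j + X a i r * v a' r j b p q).
Hypothesis vl_idem : forall s i j b p q, v (e s) i j b p q = 0.
Hypothesis vr_linear : forall k a i j b b' p q,
  v a i j (k *: b + b') p q = cst k * v a i j b p q + v a i j b' p q.
Hypothesis vrM : forall a i j b b' p q, v a i j (b * b') p q =
  \sum_r (v a i j b p r * X b' r q + X b p r * v a i j b' r q).
Hypothesis vr_idem : forall s a i j p q, v a i j (e s) p q = 0.

(** Extension in one argument at a time. For fixed [a i j], the values extend to a derivation
    [d a i j] of the second argument. For fixed [y], the family [d a i j y] again respects the
    relations of A, because each relation compares two derivations in [y] that agree on coordinates;
    so it extends in the first argument. *)
Lemma rep_biderivation : {br : B -> B -> B |
  (forall x, derivation_over cst (br x)) /\
  (forall y, derivation_over cst (br^~ y)) &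
  forall a i j b p q, br (X a i j) (X b p q) = v a i j b p q}.
Proof.
have D a i j := rep_derivation (fun k b b' => @vr_linear k a i j b b')
  (fun b b' => @vrM a i j b b') (fun s => @vr_idem s a i j).
pose d a i j := s2val (D a i j).
have dD a i j : derivation_over cst (d a i j) by exact: s2valP (D a i j).
have dX a i j b p q : d a i j (X b p q) = v a i j b p q.
  exact: s2valP' (D a i j) b p q.
have E y := @rep_derivation (fun a i j => d a i j y).
pose dext := derivation_over_ext rep_generated.
have {}E y : {D : B -> B | derivation_over cst D &
    forall a i j, D (X a i j) = d a i j y}.
  apply: E => [k a b i j|a b i j|s i j].
  - apply: (dext _ (fun y => cst k * d a i j y + d b i j y)) => [//||[[b' p] q]].
      by apply: derivation_overD; first exact: derivation_overM.
    by rewrite !dX vl_linear.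
  - apply: (dext _ (fun y => \sum_r (d a i r y * X b r j + X a i r * d b r j y)))
      => [//||[[b' p] q]].
      apply: derivation_over_sum => r; apply: derivation_overD.
        by under eq_fun do rewrite mulrC; exact: derivation_overM.
      exact: derivation_overM.
    by rewrite dX vlM; apply: eq_bigr => r _; rewrite !dX.
  - apply: (dext _ (fun=> 0)) => [//||[[b' p] q]].
      exact: derivation_over0.
    by rewrite dX vl_idem.
pose br x y := s2val (E y) x.
have brl y : derivation_over cst (br^~ y) by exact: s2valP (E y).
have brX a i j y : br (X a i j) y = d a i j y by exact: s2valP' (E y) a i j.
exists br => [|a i j b p q]; last by rewrite brX dX.
(* The second extension is a derivation in [x] by construction; that it stays a derivation in [y] is
   recovered by induction on [x]. *)
split=> // x; elim/rep_generated: x => [k|[[a i] j]|x x' IHx IHx'|x x' IHx IHx'].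
- rewrite (_ : br (cst k) = fun=> 0); first exact: derivation_over0.
  by apply/funext => y; case: (brl y) => _ ->.
- rewrite (_ : br _ = d a i j); first exact: dD.
  by apply/funext => y; rewrite brX.
- rewrite (_ : br _ = fun y => br x y + br x' y); first exact: derivation_overD.
  by apply/funext => y; case: (brl y) => ->.
- rewrite (_ : br _ = fun y => x' * br x y + x * br x' y).
    by apply: derivation_overD; exact: derivation_overM.
  by apply/funext => y; case: (brl y) => _ _ ->; rewrite mulrC.
Qed.

End Biderivation.

End RepresentationRing.

(** * Van den Bergh's Poisson bracket *)

Section TensorOperations.
Variables (K : fieldType) (A : algType K).
Local Notation AA := (tensor A A).

Lemma tens_linear_l c (a a' b : A) :
  tens (c *: a + a') b = c *: tens a b + tens a' b.
Proof. exact: (@tens_bilinear K A A).1. Qed.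
Lemma tens_linear_r c (a b b' : A) :
  tens a (c *: b + b') = c *: tens a b + tens a b'.
Proof. exact: (@tens_bilinear K A A).2. Qed.

Lemma tswap_bilinear : is_bilinear (fun a b : A => tens b a).
Proof.
by split=> [w c a a'|w c a a'] /=; rewrite ?tens_linear_l ?tens_linear_r.
Qed.

Lemma outer_bilinear (a b : A) : is_bilinear (fun d1 d2 : A => tens (a * d1) (d2 * b)).
Proof.
split=> [w c d d'|w c d d'] /=.
  by rewrite mulrDr -scalerAr tens_linear_l.
by rewrite mulrDl -scalerAl tens_linear_r.
Qed.

Lemma inner_bilinear (a b : A) : is_bilinear (fun d1 d2 : A => tens (d1 * b) (a * d2)).
Proof.
split=> [w c d d'|w c d d'] /=.
  by rewrite mulrDl -scalerAl tens_linear_l.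
by rewrite mulrDr -scalerAr tens_linear_r.
Qed.

Lemma tmap_bilinear (f : A -> A) : linear f ->
  is_bilinear (fun d1 d2 : A => tens (f d1) (f d2)).
Proof.
by move=> fl; split=> [w c d d'|w c d d'] /=;
  rewrite fl ?tens_linear_l ?tens_linear_r.
Qed.

Lemma dbrL_bilinear (dbr : A -> A -> AA) (a : A) : linear (dbr a) ->
  is_bilinear (fun d1 d2 : A => tens (dbr a d1) d2).
Proof.
move=> dl; split=> [w c d d'|w c d d'] /=.
  by rewrite dl; exact: (@tens_bilinear K AA A).1.
exact: (@tens_bilinear K AA A).2.
Qed.

Lemma tau123_inner_bilinear (a3 : A) :
  is_bilinear (fun a1 a2 : A => tens (tens a3 a1) a2).
Proof.
split=> [w c d d'|w c d d'] /=.
  by rewrite tens_linear_r; exact: (@tens_bilinear K AA A).1.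
exact: (@tens_bilinear K AA A).2.
Qed.

Lemma tau123_bilinear : is_bilinear (fun (d : AA) (a3 : A) =>
  tlift (fun a1 a2 => tens (tens a3 a1) a2) d).
Proof.
split=> [w|d c a a'] /=; first exact: tlift_linear (tau123_inner_bilinear w).
pose F (a3 : A) (d : AA) := tlift (fun a1 a2 => tens (tens a3 a1) a2) d.
have FE a3 a1 a2 : F a3 (tens a1 a2) = tens (tens a3 a1) a2.
  exact: tlift_tens (tau123_inner_bilinear a3) _ _.
have FD a3 x y : F a3 (x + y) = F a3 x + F a3 y.
  exact: tliftD (tau123_inner_bilinear a3) _ _.
rewrite -[LHS]/(F (c *: a + a') d) -[RHS]/(c *: F a d + F a' d).
move: F FE FD => F FE FD; elim/tens_ind: d => [a1 a2|x y IHx IHy].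
  rewrite !FE tens_linear_l.
  exact: (@tens_bilinear K AA A).1.
by rewrite !FD IHx IHy scalerDr addrACA.
Qed.

Lemma tswap_tens (a b : A) : tswap (tens a b) = tens b a.
Proof. exact: tlift_tens tswap_bilinear _ _. Qed.
Lemma tswapD (d d' : AA) : tswap (d + d') = tswap d + tswap d'.
Proof. exact: tliftD tswap_bilinear _ _. Qed.
Lemma outer_tens (a b d1 d2 : A) : outer a (tens d1 d2) b = tens (a * d1) (d2 * b).
Proof. exact: tlift_tens (outer_bilinear a b) _ _. Qed.
Lemma outerD (a b : A) d d' : outer a (d + d') b = outer a d b + outer a d' b.
Proof. exact: tliftD (outer_bilinear a b) _ _. Qed.
Lemma inner_tens (a b d1 d2 : A) : inner a (tens d1 d2) b = tens (d1 * b) (a * d2).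
Proof. exact: tlift_tens (inner_bilinear a b) _ _. Qed.
Lemma innerD (a b : A) d d' : inner a (d + d') b = inner a d b + inner a d' b.
Proof. exact: tliftD (inner_bilinear a b) _ _. Qed.
Lemma tau123_tens (a1 a2 a3 : A) :
  tau123 (tens (tens a1 a2) a3) = tens (tens a3 a1) a2.
Proof.
rewrite /tau123 (tlift_tens tau123_bilinear).
exact: tlift_tens (tau123_inner_bilinear a3) _ _.
Qed.
Lemma tau123D (t t' : tensor AA A) : tau123 (t + t') = tau123 t + tau123 t'.
Proof. exact: tliftD tau123_bilinear _ _. Qed.
Lemma tens_add_l (W : lmodType K) (x y : W) (a : A) :
  tens (x + y) a = tens x a + tens y a.
Proof. by have := (@tens_bilinear K W A).1 a 1 x y; rewrite !scale1r. Qed.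

Section LinearMap.
Variables (f : A -> A) (fl : linear f).

Lemma tmap_tens (a b : A) : tmap f (tens a b) = tens (f a) (f b).
Proof. exact: tlift_tens (tmap_bilinear fl) _ _. Qed.
Lemma tmapD (d d' : AA) : tmap f (d + d') = tmap f d + tmap f d'.
Proof. exact: tliftD (tmap_bilinear fl) _ _. Qed.

End LinearMap.

Section DbrL.
Variables (dbr : A -> A -> AA) (a : A).
Hypothesis dbr_linear : linear (dbr a).

Lemma dbrL_tens (b c : A) : dbrL dbr a (tens b c) = tens (dbr a b) c.
Proof. exact: tlift_tens (dbrL_bilinear dbr_linear) _ _. Qed.
Lemma dbrLD (d d' : AA) : dbrL dbr a (d + d') = dbrL dbr a d + dbrL dbr a d'.
Proof. exact: tliftD (dbrL_bilinear dbr_linear) _ _. Qed.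
Lemma dbrLN (d : AA) : dbrL dbr a (- d) = - dbrL dbr a d.
Proof. exact: tliftN (dbrL_bilinear dbr_linear) _. Qed.

End DbrL.

End TensorOperations.

(** * The bracket induced by a double bracket *)

Section StandardBracket.
Variables (K : fieldType) (A : algType K) (n : nat) (e : 'I_n -> A).
Variable alpha : 'I_n -> nat.
Local Notation N := (\sum_s alpha s)%N.
Local Notation B := (rep_ring e alpha).
Local Notation cst := (rep_cst e alpha).
Local Notation X := (@rep_coord K A n e alpha).
Local Notation AA := (tensor A A).

Lemma tc_bilinear u v w z : is_bilinear (fun d1 d2 => X d1 u v * X d2 w z).
Proof.
split=> [b c d d'|b c d d'] /=; rewrite rep_coord_linear rep_scaleE.
  by rewrite mulrDl mulrA.
by rewrite mulrDr mulrCA.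
Qed.

(* Sealed, as unification is slow when it looks inside. *)
Fact rep_tensor_coord_key : unit. Proof. exact: tt. Qed.
Definition rep_tensor_coord : AA -> 'I_N -> 'I_N -> 'I_N -> 'I_N -> B :=
  locked_with rep_tensor_coord_key
    (fun d u v w z => tlift (fun d1 d2 => X d1 u v * X d2 w z) d).
Local Notation tc := rep_tensor_coord.

Lemma tcE d u v w z : tc d u v w z = tlift (fun d1 d2 => X d1 u v * X d2 w z) d.
Proof. by rewrite /tc locked_withE. Qed.
Lemma tc_linear u v w z c d d' :
  tc (c *: d + d') u v w z = cst c * tc d u v w z + tc d' u v w z.
Proof. by rewrite !tcE; exact: tlift_linear (tc_bilinear u v w z) c d d'. Qed.
Lemma tc_tens a b u v w z : tc (tens a b) u v w z = X a u v * X b w z.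
Proof. by rewrite tcE; exact: (tlift_tens (tc_bilinear u v w z)). Qed.
Lemma tcD d d' u v w z : tc (d + d') u v w z = tc d u v w z + tc d' u v w z.
Proof. by rewrite !tcE; exact: (tliftD (tc_bilinear u v w z)). Qed.
Lemma tcN d u v w z : tc (- d) u v w z = - tc d u v w z.
Proof. by rewrite !tcE; exact: (tliftN (tc_bilinear u v w z)). Qed.
Lemma tc0 u v w z : tc 0 u v w z = 0.
Proof. by rewrite tcE; exact: (tlift0 (tc_bilinear u v w z)). Qed.

Lemma tc3_bilinear p q u v w z :
  is_bilinear (fun d a => tc d p q u v * X a w z).
Proof.
split=> [b c d d'|b c d d'] /=; rewrite ?rep_coord_linear rep_scaleE.
  by rewrite tc_linear mulrDl mulrA.
by rewrite mulrDr mulrCA.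
Qed.

Definition rep_tensor3_coord :
    tensor AA A -> 'I_N -> 'I_N -> 'I_N -> 'I_N -> 'I_N -> 'I_N -> B :=
  locked_with rep_tensor_coord_key
    (fun t p q u v w z => tlift (fun d a => tc d p q u v * X a w z) t).
Local Notation tc3 := rep_tensor3_coord.

Lemma tc3E t p q u v w z :
  tc3 t p q u v w z = tlift (fun d a => tc d p q u v * X a w z) t.
Proof. by rewrite /tc3 locked_withE. Qed.
Lemma tc3_tens d a p q u v w z :
  tc3 (tens d a) p q u v w z = tc d p q u v * X a w z.
Proof. by rewrite tc3E; exact: (tlift_tens (tc3_bilinear p q u v w z)). Qed.
Lemma tc3D s t p q u v w z :
  tc3 (s + t) p q u v w z = tc3 s p q u v w z + tc3 t p q u v w z.
Proof. by rewrite !tc3E; exact: (tliftD (tc3_bilinear p q u v w z)). Qed.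
Lemma tc3N s p q u v w z : tc3 (- s) p q u v w z = - tc3 s p q u v w z.
Proof. by rewrite !tc3E; exact: (tliftN (tc3_bilinear p q u v w z)). Qed.
Lemma tc30 p q u v w z : tc3 0 p q u v w z = 0.
Proof. by rewrite tc3E; exact: (tlift0 (tc3_bilinear p q u v w z)). Qed.

Lemma tc_tswap d u v w z : tc (tswap d) u v w z = tc d w z u v.
Proof.
move: d; apply: tlift_ext => [x y|x y|a b]; [by rewrite tswapD tcD|exact: tcD|].
by rewrite tswap_tens [LHS]tc_tens [RHS]tc_tens mulrC.
Qed.

Lemma tc_sum_l (I : finType) (c : I -> B) (u v w z : I -> 'I_N) d d' :
  \sum_r c r * tc (d + d') (u r) (v r) (w r) (z r) =
  \sum_r c r * tc d (u r) (v r) (w r) (z r)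
    + \sum_r c r * tc d' (u r) (v r) (w r) (z r).
Proof. by rewrite -big_split; apply: eq_bigr => r _; rewrite tcD mulrDr. Qed.

Lemma tc_outer_r d c u v w z :
  tc (outer 1 d c) u v w z = \sum_r X c r z * tc d u v w r.
Proof.
move: d; apply: tlift_ext => [x y|x y|a b]; first by rewrite outerD tcD.
  exact: tc_sum_l.
rewrite outer_tens [LHS]tc_tens mul1r rep_coordM mulr_sumr.
by apply: eq_bigr => r _; rewrite tc_tens mulrA mulrC.
Qed.

Lemma tc_outer_l d b u v w z :
  tc (outer b d 1) u v w z = \sum_r X b u r * tc d r v w z.
Proof.
move: d; apply: tlift_ext => [x y|x y|a c]; first by rewrite outerD tcD.
  exact: tc_sum_l.
rewrite outer_tens [LHS]tc_tens mulr1 rep_coordM mulr_suml.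
by apply: eq_bigr => r _; rewrite tc_tens mulrA.
Qed.

Lemma tc_inner_r d c u v w z :
  tc (inner 1 d c) u v w z = \sum_r X c r v * tc d u r w z.
Proof.
move: d; apply: tlift_ext => [x y|x y|a b]; first by rewrite innerD tcD.
  exact: tc_sum_l.
rewrite inner_tens [LHS]tc_tens mul1r rep_coordM mulr_suml.
by apply: eq_bigr => r _; rewrite tc_tens mulrA [_ * X a _ _]mulrC.
Qed.

Lemma tc_inner_l d b u v w z :
  tc (inner b d 1) u v w z = \sum_r X b w r * tc d u v r z.
Proof.
move: d; apply: tlift_ext => [x y|x y|a c]; first by rewrite innerD tcD.
  exact: tc_sum_l.
rewrite inner_tens [LHS]tc_tens mulr1 rep_coordM mulr_sumr.
by apply: eq_bigr => r _; rewrite tc_tens mulrCA.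
Qed.

(** In coordinates, the rotations in the double Jacobiator become cyclic permutations of the three
    index pairs. *)
Lemma tc3_tau123 t p q u v w z : tc3 (tau123 t) p q u v w z = tc3 t u v w z p q.
Proof.
move: t; apply: tlift_ext => [x y|x y|d c]; [by rewrite tau123D tc3D|exact: tc3D|].
move: d; apply: tlift_ext => [x y|x y|a b].
- by rewrite tens_add_l tau123D; exact: tc3D.
- by rewrite tens_add_l; exact: tc3D.
- rewrite tau123_tens [LHS]tc3_tens [RHS]tc3_tens [in LHS]tc_tens [in RHS]tc_tens.
  by rewrite [RHS]mulrC mulrA.
Qed.

Variable dbr : A -> A -> AA.
Hypothesis dbr_bracket : double_bracket e dbr.

Lemma dbr_linear_r a : linear (dbr a).
Proof. by case: dbr_bracket => -[]. Qed.
Lemma dbr_linear_l b : linear (dbr^~ b).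
Proof. by case: dbr_bracket => -[]. Qed.

Lemma dbr_idem s a : dbr (e s) a = 0 /\ dbr a (e s) = 0.
Proof.
case: dbr_bracket => _ _ _ _ /(_ (fun t => (t == s)%:R) a).
rewrite (_ : \sum_t _ = e s) // (bigD1 s) //= eqxx scale1r big1 ?addr0 // => t ts.
by rewrite (negPf ts) scale0r.
Qed.

(** In the index pattern [k j i l], the outer positions carry the indices of [b] and the inner
    positions those of [a]. Hence the outer and inner Leibniz rules of the double bracket become the
    Leibniz rules for products of matrices in [b] and in [a]. *)
Lemma standard_bracket : {br : B -> B -> B |
  (forall x, derivation_over cst (br x)) /\
  (forall y, derivation_over cst (br^~ y)) &
  forall a i j b k l, br (X a i j) (X b k l) = tc (dbr a b) k j i l}.
Proof.
apply: (@rep_biderivation _ _ _ e alpha (fun a i j b k l => tc (dbr a b) k j i l)).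
- by move=> c a a' i j b k l; rewrite dbr_linear_l tc_linear.
- move=> a a' i j b k l; case: dbr_bracket => _ _ _ -> _.
  rewrite tcD [X in X + _]tc_inner_r [X in _ + X]tc_inner_l -big_split.
  by apply: eq_bigr => r _; congr (_ + _); exact: mulrC.
- by move=> s i j b k l; rewrite (dbr_idem s b).1 tc0.
- by move=> c a i j b b' k l; rewrite dbr_linear_r tc_linear.
- move=> a i j b b' k l; case: dbr_bracket => _ _ -> _ _.
  rewrite tcD [X in X + _]tc_outer_r [X in _ + X]tc_outer_l -big_split.
  by apply: eq_bigr => r _; congr (_ + _); exact: mulrC.
- by move=> s a i j k l; rewrite (dbr_idem s a).2 tc0.
Qed.

Variable sbr : B -> B -> B.
Hypothesis sbr_derivation_r : forall x, derivation_over cst (sbr x).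
Hypothesis sbr_derivation_l : forall y, derivation_over cst (sbr^~ y).
Hypothesis sbr_coord : forall a i j b k l,
  sbr (X a i j) (X b k l) = tc (dbr a b) k j i l.

Lemma sbr_antisym x y : sbr x y = - sbr y x.
Proof.
pose ext := derivation_over_ext (@rep_generated _ _ _ e alpha).
move: x; apply: (ext _ (fun x => - sbr y x)) => [//||].
  exact: derivation_overN.
move=> [[a i] j] /=; move: y; apply: (ext _ (fun y => - sbr y (X a i j))) => //.
  exact: (derivation_overN (sbr_derivation_l _)).
move=> [[b k] l] /=; rewrite [LHS]sbr_coord [in RHS]sbr_coord.
by case: dbr_bracket => _ -> _ _ _; rewrite tcN tc_tswap.
Qed.

(** The derivation hits each of the two factors in turn. As [dbrL] acts on the left factor only, the
    second contribution is read off from the swapped tensor. *)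
Lemma sbr_tensor a i j d u l k v : sbr (X a i j) (tc d u l k v) =
  tc3 (dbrL dbr a d) u j i l k v + tc3 (dbrL dbr a (tswap d)) k j i v u l.
Proof.
have [sD _ sM] := sbr_derivation_r (X a i j).
have aL := dbr_linear_r a.
move: d; apply: tlift_ext => [x y|x y|b c].
- by rewrite tcD sD.
- by rewrite tswapD dbrLD // tc3D [in LHS]dbrLD // [in LHS]tc3D addrACA.
rewrite tc_tens sM !sbr_coord tswap_tens [dbrL _ _ (tens b c)]dbrL_tens //.
rewrite [dbrL _ _ (tens c b)]dbrL_tens // [X in _ = X + _]tc3_tens.
by rewrite [X in _ = _ + X]tc3_tens [X b u l * _]mulrC.
Qed.

Lemma sbr_dbr a i j b k l c u v : sbr (X a i j) (sbr (X b k l) (X c u v)) =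
  tc3 (dbrL dbr a (dbr b c)) u j i l k v - tc3 (dbrL dbr a (dbr c b)) k j i v u l.
Proof.
have -> : dbr c b = - tswap (dbr b c) by case: dbr_bracket.
by rewrite sbr_coord sbr_tensor dbrLN ?tc3N ?opprK //; exact: dbr_linear_r.
Qed.

Hypothesis dbr_jacobi : forall a b c, double_jacobiator dbr a b c = 0.

Lemma tc3_jacobiator a b c p q u v w z :
  tc3 (dbrL dbr a (dbr b c)) p q u v w z
  + tc3 (dbrL dbr b (dbr c a)) u v w z p q
  + tc3 (dbrL dbr c (dbr a b)) w z p q u v = 0.
Proof.
have := congr1 (fun t => tc3 t p q u v w z) (dbr_jacobi a b c).
rewrite /double_jacobiator tc3D [X in X + _]tc3D tc30 => <-.
congr (_ + _ + _); first by rewrite tc3_tau123.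
by rewrite [RHS]tc3_tau123 [RHS]tc3_tau123.
Qed.

(** Each double bracket inside contributes two terms by [sbr_dbr], with opposite signs by
    antisymmetry. The six terms regroup into one coordinate of the double Jacobiator of [a, b, c]
    minus one of that of [a, c, b]. *)
Lemma sbr_jacobi_coord a i j b k l c u v :
  sbr (X a i j) (sbr (X b k l) (X c u v))
  + sbr (X b k l) (sbr (X c u v) (X a i j))
  + sbr (X c u v) (sbr (X a i j) (X b k l)) = 0.
Proof.
rewrite (sbr_dbr a i j b k l c u v) (sbr_dbr b k l c u v a i j).
rewrite (sbr_dbr c u v a i j b k l).
have J1 := tc3_jacobiator a b c u j i l k v.
have J2 := tc3_jacobiator a c b k j i v u l.
have zmod6 (M : zmodType) (t1 t2 t3 s1 s2 s3 : M) :
  t1 + t2 + t3 = 0 -> s1 + s3 + s2 = 0 ->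
  t1 - s1 + (t2 - s2) + (t3 - s3) = 0.
  move=> t0 s0; rewrite [X in X + _]addrACA [LHS]addrACA t0 -!opprD addrAC s0.
  exact: subrr.
exact: zmod6 J1 J2.
Qed.

Definition jacobiator x y z := sbr x (sbr y z) + sbr y (sbr z x) + sbr z (sbr x y).

Lemma jacobiator_cycle x y z : jacobiator x y z = jacobiator y z x.
Proof. by rewrite /jacobiator -[LHS]addrA [LHS]addrC. Qed.

(** By antisymmetry this is the commutator of the derivations [sbr x] and [sbr y] minus the
    derivation [sbr (sbr x y)]; in the commutator the mixed terms of the Leibniz rule cancel. *)
Lemma jacobiator_derivation x y : derivation_over cst (jacobiator x y).
Proof.
have [xD xC xM] := sbr_derivation_r x.
have [yD yC yM] := sbr_derivation_r y.
have [zD zC zM] := sbr_derivation_r (sbr x y).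
have yN z := derivation_over_opp z (sbr_derivation_r y).
have -> : jacobiator x y =
    fun z => sbr x (sbr y z) - sbr y (sbr x z) - sbr (sbr x y) z.
  apply/funext => z.
  by rewrite /jacobiator (sbr_antisym z x) (sbr_antisym z (sbr x y)) yN.
split=> [z z'|k|z z'].
- by rewrite yD !xD yD zD !opprD [X in X + _]addrACA [LHS]addrACA.
- by rewrite yC xC -(rmorph0 cst) xC yC zC rmorph0 !subr0.
rewrite yM xD !xM yD !yM zM !mulrBl !mulrBr.
have zmod8 (M : zmodType) (p q r p' s s' t t' : M) :
    p + q + (r + p') - (s + r + (q + s')) - (t + t') = p - s - t + (p' - s' - t').
  have swap (a b c d : M) : a + b + (c + d) = a + d + (c + b).
    by rewrite addrACA [b + d]addrC addrACA.
  rewrite [p + q + _]swap [s + r + _]swap [q + r]addrC opprD.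
  rewrite [X in X + _]addrACA subrr addr0.
  by rewrite opprD [X in X + _]addrACA opprD [LHS]addrACA.
exact: zmod8.
Qed.

(** Being a derivation in its last argument, the Jacobiator vanishes once it does so for coordinates
    there; cyclic invariance brings each argument to the last place. *)
Lemma sbr_jacobi x y z : jacobiator x y z = 0.
Proof.
have ext x' y' : (forall a i j, jacobiator x' y' (X a i j) = 0) ->
    forall z', jacobiator x' y' z' = 0.
  move=> Jc; apply: (derivation_over_ext (@rep_generated _ _ _ e alpha)
    (jacobiator_derivation x' y') (derivation_over0 cst)) => -[[a i] j].
  exact: Jc.
apply: (ext) => c u v; rewrite jacobiator_cycle jacobiator_cycle.
move: y; apply: (ext) => b k l; rewrite jacobiator_cycle jacobiator_cycle.
move: x; apply: (ext) => a i j; rewrite jacobiator_cycle.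
exact: sbr_jacobi_coord.
Qed.

End StandardBracket.

(** * The symplectic involution of matrices *)

Fact sp_star_key : unit. Proof. exact: tt. Qed.

Section SymplecticInvolution.
Variables (n : nat) (alpha : 'I_n -> nat) (R : comPzRingType).
Local Notation N := (\sum_s alpha s)%N.
Hypothesis alpha_even : forall s, ~~ odd (alpha s).
Local Notation Om := (block_Omega alpha R).
Implicit Types (i j : 'I_N) (x y : 'M[R]_N).

Lemma sgn_mul_self i : sgn R i * sgn R i = 1.
Proof. by rewrite /sgn; case: ifP; rewrite ?mulrNN mulr1. Qed.

(** Evenness enters here: the block has exactly twice [d] positions, so subtracting [d] from a
    position in the second half lands in the first half. *)
Lemma first_half_tau i : first_half (tau i) = ~~ first_half i.
Proof.
rewrite /first_half sig2_tau sig1_tau /=.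
have := ltn_ord (tagnat.sig2 i).
have := even_halfK (alpha_even (tagnat.sig1 i)); rewrite -addnn.
move: (nat_of_ord (tagnat.sig2 i)) ((alpha (tagnat.sig1 i))./2) => p d <-.
case: (ltnP p d) => [_ _|le_dp lt_p]; first by rewrite ltnNge leq_addl.
by rewrite ltn_subLR.
Qed.

Lemma tauK : involutive (@tau n alpha).
Proof.
move=> i; apply: sig_val_inj; first by rewrite !sig1_tau.
rewrite sig2_tau /= -/(first_half (tau i)) first_half_tau sig2_tau sig1_tau /=.
by rewrite /first_half; case: ltnP => [_|le_dp] /=; rewrite ?addnK ?subnK.
Qed.

Lemma sgn_tau i : sgn R (tau i) = - sgn R i.
Proof. by rewrite /sgn first_half_tau; case: (first_half i) => /=; rewrite ?opprK. Qed.

Lemma trmx_block_Omega : Om^T = - Om.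
Proof.
apply/matrixP => i j; rewrite [LHS]mxE [RHS]mxE.
rewrite !(block_OmegaE R alpha_even) [i == _]eq_sym (can2_eq tauK tauK).
by case: eqP => [->|_]; rewrite ?oppr0 // sgn_tau.
Qed.

Lemma mul_block_Omega_tr : Om *m Om^T = 1%:M.
Proof.
have trE k l : Om^T k l = Om l k by rewrite mxE.
apply/matrixP => i j; rewrite [LHS]mxE [RHS]mxE (bigD1 (tau i)) //=.
rewrite [X in _ + X]big1 => [|k ki].
  rewrite trE !(block_OmegaE R alpha_even) eqxx addr0.
  rewrite (inj_eq (can_inj tauK)).
  by case: eqP => [->|_]; rewrite ?mulr0 // sgn_mul_self.
by rewrite (block_OmegaE R alpha_even) (negPf ki) mul0r.
Qed.

Lemma mul_block_Omega : Om *m Om = - 1%:M.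
Proof. by rewrite -mul_block_Omega_tr trmx_block_Omega mulmxN opprK. Qed.

Lemma mul_tr_block_Omega : Om^T *m Om = 1%:M.
Proof. by rewrite trmx_block_Omega mulNmx mul_block_Omega opprK. Qed.

(** This is the involution of the matrix algebra that the theorem calls tau; in the code [tau] is
    the permutation of the indices. It is taken over any commutative ring, because it is applied
    over the base field and over both coordinate rings. *)
Definition sp_star : 'M[R]_N -> 'M[R]_N :=
  locked_with sp_star_key (fun x => Om *m x^T *m Om^T).

Lemma sp_star_def x : sp_star x = Om *m x^T *m Om^T.
Proof. by rewrite /sp_star locked_withE. Qed.

Lemma sp_starE x i j : sp_star x i j = sgn R i * sgn R j * x (tau j) (tau i).
Proof. by rewrite sp_star_def Omega_involution. Qed.

Lemma sp_starM x y : sp_star (x *m y) = sp_star y *m sp_star x.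
Proof.
rewrite !sp_star_def trmx_mul !mulmxA.
by rewrite -[_ *m Om^T *m Om]mulmxA mul_tr_block_Omega mulmx1.
Qed.

Lemma sp_starK : involutive sp_star.
Proof.
move=> x; rewrite !sp_star_def !trmx_mul !trmxK !mulmxA mul_block_Omega mulNmx.
rewrite mul1mx trmx_block_Omega !mulmxN !mulNmx !opprK.
by rewrite -mulmxA mul_block_Omega mulmxN mulmx1 opprK.
Qed.

Lemma sp_starB x y : sp_star (x - y) = sp_star x - sp_star y.
Proof. by rewrite !sp_star_def linearB mulmxBr mulmxBl. Qed.

(** An entrywise form without the dependent blocks of [\mxdiag]; it is what commuting with the
    idempotents and changing the base ring require. *)
Definition block_diagonal x : Prop :=
  forall i j, tagnat.sig1 i != tagnat.sig1 j -> x i j = 0.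

Lemma block_diagonal_mxdiag (y : forall s, 'M[R]_(alpha s)) :
  block_diagonal (\mxdiag_s y s).
Proof. by move=> i j ij; rewrite /mxdiag !mxE (negPf ij) mxE. Qed.

Lemma block_diagonalP x : block_diagonal x -> x = \mxdiag_s submxblock x s s.
Proof.
move=> xd; rewrite -[LHS]submxblockK; apply/eq_mxblock => s t.
case: eqVneq => [->|st]; first by rewrite conform_mx_id.
apply/matrixP => i j; rewrite !mxE; apply: xd.
by rewrite !tagnat.Rank1K.
Qed.

Lemma mul_mxdiag (y z : forall s, 'M[R]_(alpha s)) :
  (\mxdiag_s y s) *m (\mxdiag_s z s) = \mxdiag_s (y s *m z s).
Proof.
rewrite [X in _ *m X]/mxdiag mul_mxdiag_mxblock; apply/eq_mxblock => s t.
by case: eqVneq => [->|_]; rewrite ?conform_mx_id ?mulmx0.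
Qed.

Definition idem_mx (s : 'I_n) : 'M[R]_N :=
  \matrix_(i, j) if (i == j) && (tagnat.sig1 i == s) then 1 else 0.

Lemma mul_idem_mx s x i j :
  (idem_mx s *m x) i j = if tagnat.sig1 i == s then x i j else 0.
Proof.
rewrite mxE (bigD1 i) //= [X in _ + X]big1 => [|k ki]; rewrite !mxE.
  by rewrite eqxx addr0 /=; case: ifP => _; rewrite ?mul1r ?mul0r.
by rewrite eq_sym (negPf ki) mul0r.
Qed.

Lemma mul_mx_idem s x i j :
  (x *m idem_mx s) i j = if tagnat.sig1 j == s then x i j else 0.
Proof.
rewrite mxE (bigD1 j) //= [X in _ + X]big1 => [|k kj]; rewrite !mxE.
  by rewrite eqxx addr0 /=; case: ifP => _; rewrite ?mulr1 ?mulr0.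
by rewrite (negPf kj) mulr0.
Qed.

Lemma block_diagonal_comm s x :
  block_diagonal x -> x *m idem_mx s = idem_mx s *m x.
Proof.
move=> xd; apply/matrixP => i j; rewrite mul_idem_mx mul_mx_idem.
have [-> //|ij] := eqVneq (tagnat.sig1 i) (tagnat.sig1 j).
by rewrite xd // !if_same.
Qed.

(** The blockwise conditions assemble into [x^T *m Om + Om *m x = 0], and multiplying by [Om], whose
    square is -1, turns this into anti-invariance under [sp_star]. *)
Lemma sp_algebraP x : sp_algebra x <-> sp_star x = - x /\ block_diagonal x.
Proof.
split=> [[y yO ->]|[sx xd]].
  split; last exact: block_diagonal_mxdiag.
  have xO : (\mxdiag_s y s)^T *m Om = - (Om *m \mxdiag_s y s).
    apply/eqP; rewrite -addr_eq0 tr_mxdiag !mul_mxdiag -mxdiagD.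
    by under eq_mxdiag do rewrite yO; rewrite mxdiag0.
  rewrite !sp_star_def trmx_block_Omega mulmxN -mulmxA xO mulmxN opprK mulmxA.
  by rewrite mul_block_Omega mulNmx mul1mx.
exists (fun s => submxblock x s s); last exact: block_diagonalP.
suff : x^T *m Om + Om *m x = 0.
  rewrite [x]block_diagonalP // tr_mxdiag !mul_mxdiag -mxdiagD -mxdiag0 => xO.
  by move=> s; move/eq_mxdiagP: xO => /(_ s); rewrite /= !submxblock_diag.
have -> : x^T = Om *m x *m Om.
  rewrite -[x in RHS]opprK -sx sp_star_def mulmxN mulNmx !mulmxA mul_block_Omega.
  by rewrite -[_ *m Om^T *m Om]mulmxA mul_tr_block_Omega mulmx1 !mulNmx mul1mx opprK.
by rewrite -[_ *m Om *m Om]mulmxA mul_block_Omega mulmxN mulmx1 addNr.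
Qed.

Lemma Sp_group_mul_star (g : 'M[R]_N) : Sp_group g ->
  sp_star g *m g = 1%:M /\ block_diagonal g.
Proof.
case=> h hO ->; split; last exact: block_diagonal_mxdiag.
rewrite !sp_star_def trmx_block_Omega mulmxN mulNmx -!mulmxA tr_mxdiag.
rewrite [X in - (_ *m X)](_ : _ = Om) ?mul_block_Omega ?opprK //.
by rewrite mulmxA !mul_mxdiag; apply: eq_mxdiag => s; exact: hO.
Qed.

End SymplecticInvolution.

Section SymplecticMap.
Variables (n : nat) (alpha : 'I_n -> nat) (R S : comPzRingType).
Variable f : {rmorphism R -> S}.
Local Notation N := (\sum_s alpha s)%N.

Lemma rmorph_sgn (i : 'I_N) : f (sgn R i) = sgn S i.
Proof. by rewrite /sgn; case: ifP; rewrite ?rmorphN rmorph1. Qed.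

Hypothesis alpha_even : forall s, ~~ odd (alpha s).

Lemma map_block_Omega : map_mx f (block_Omega alpha R) = block_Omega alpha S.
Proof.
apply/matrixP => i j; rewrite mxE !(block_OmegaE _ alpha_even).
by case: eqP; rewrite ?rmorph0 ?rmorph_sgn.
Qed.

Lemma map_sp_star (x : 'M[R]_N) : map_mx f (sp_star x) = sp_star (map_mx f x).
Proof. by rewrite !sp_star_def !map_mxM -!map_trmx !map_block_Omega. Qed.

Lemma map_block_diagonal (x : 'M[R]_N) :
  block_diagonal x -> block_diagonal (map_mx f x).
Proof. by move=> xd i j ij; rewrite mxE xd ?rmorph0. Qed.

End SymplecticMap.

(** * Matrix form of the universal property *)

Section MatrixCoordinates.
Variables (K : fieldType) (A : algType K) (n : nat) (e : 'I_n -> A).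
Variable alpha : 'I_n -> nat.
Local Notation N := (\sum_s alpha s)%N.
Local Notation B := (rep_ring e alpha).
Local Notation cst := (rep_cst e alpha).
Local Notation X := (@rep_coord K A n e alpha).
Local Notation tc := (@rep_tensor_coord K A n e alpha).

Definition rep_mx (a : A) : 'M[B]_N := \matrix_(i, j) X a i j.

Lemma rep_mx_linear c a b : rep_mx (c *: a + b) = cst c *: rep_mx a + rep_mx b.
Proof. by apply/matrixP => i j; rewrite !mxE rep_coord_linear. Qed.

Lemma rep_mxM a b : rep_mx (a * b) = rep_mx a *m rep_mx b.
Proof.
apply/matrixP => i j; rewrite !mxE rep_coordM.
by apply: eq_bigr => r _; rewrite !mxE.
Qed.

Lemma rep_mx_idem s : rep_mx (e s) = idem_mx alpha B s.
Proof. by apply/matrixP => i j; rewrite !mxE rep_coord_idem. Qed.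

Lemma rep_lift_mx (S : comPzRingType) (c : {rmorphism K -> S}) (F : A -> 'M[S]_N) :
    (forall k a b, F (k *: a + b) = c k *: F a + F b) ->
    (forall a b, F (a * b) = F a *m F b) ->
    (forall s, F (e s) = idem_mx alpha S s) ->
  {g : {rmorphism B -> S} |
    (forall k, g (cst k) = c k) & (forall a, map_mx g (rep_mx a) = F a)}.
Proof.
move=> FL FM Fe; have [k a b i j|a b i j|s i j|g gC gX] :=
  @rep_lift K A n e alpha S c (fun a i j => F a i j).
- by rewrite FL !mxE.
- by rewrite FM mxE.
- by rewrite Fe mxE.
by exists g => // a; apply/matrixP => i j; rewrite !mxE gX.
Qed.

Lemma rep_derivation_mx (F : A -> 'M[B]_N) :
    (forall k a b, F (k *: a + b) = cst k *: F a + F b) ->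
    (forall a b, F (a * b) = F a *m rep_mx b + rep_mx a *m F b) ->
    (forall s, F (e s) = 0) ->
  {D : B -> B | derivation_over cst D & (forall a, map_mx D (rep_mx a) = F a)}.
Proof.
move=> FL FM Fe; have [k a b i j|a b i j|s i j|D DD DX] :=
  @rep_derivation K A n e alpha (fun a i j => F a i j).
- by rewrite FL !mxE.
- rewrite FM !mxE big_split.
  by congr (_ + _); apply: eq_bigr => r _; rewrite mxE.
- by rewrite Fe mxE.
by exists D => // a; apply/matrixP => i j; rewrite !mxE DX.
Qed.

Lemma rep_rmorphism_ext (T : pzRingType) (f g : {rmorphism B -> T}) :
    (forall k, f (cst k) = g (cst k)) ->
    (forall a, map_mx f (rep_mx a) = map_mx g (rep_mx a)) ->
  f =1 g.
Proof.
move=> fgC fgX; apply: (rmorphism_ext (@rep_generated K A n e alpha)) => // -[[a i] j].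
by have /matrixP/(_ i j) := fgX a; rewrite !mxE.
Qed.

Lemma rep_derivation_ext (D D' : B -> B) :
    derivation_over cst D -> derivation_over cst D' ->
    (forall a, map_mx D (rep_mx a) = map_mx D' (rep_mx a)) ->
  D =1 D'.
Proof.
move=> DD DD' eqX.
apply: (derivation_over_ext (@rep_generated K A n e alpha)) => // -[[a i] j].
by have /matrixP/(_ i j) := eqX a; rewrite !mxE.
Qed.

Section Equivariance.
Variable sbr : B -> B -> B.
Hypothesis sbr_derivation_r : forall x, derivation_over cst (sbr x).
Hypothesis sbr_derivation_l : forall y, derivation_over cst (sbr^~ y).

(** Pulling the bracket of [f x] and [f y] back along the inverse [g] gives a derivation in each
    argument, which can be compared with [sbr] on coordinates. *)
Lemma bracket_equivariant (f g : {rmorphism B -> B}) :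
    cancel f g -> cancel g f -> (forall k, f (cst k) = cst k) ->
    (forall a i j b k l, sbr (f (X a i j)) (f (X b k l)) =
                         f (sbr (X a i j) (X b k l))) ->
  forall x y, f (sbr x y) = sbr (f x) (f y).
Proof.
move=> fK gK fC fX x y; rewrite -[RHS]gK; congr (f _); apply/esym.
pose ext := derivation_over_ext (@rep_generated K A n e alpha).
move: x; apply: (ext _ (sbr^~ y)) => [|//|[[a i] j]] /=.
  exact: (derivation_over_conj fK fC (sbr_derivation_l _)).
move: y; apply: (ext _ (sbr (X a i j))) => [|//|[[b k] l]] /=.
  exact: (derivation_over_conj fK fC (sbr_derivation_r _)).
by rewrite fX fK.
Qed.

Lemma bracket_sum (I J : finType) (c : I -> K) (d : J -> K) (x : I -> B) (y : J -> B) :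
  sbr (\sum_i cst (c i) * x i) (\sum_j cst (d j) * y j) =
  \sum_i \sum_j cst (c i * d j) * sbr (x i) (y j).
Proof.
rewrite (big_morph (sbr^~ _) (id1 := 0) (op1 := +%R)); last 2 first.
- by move=> u v; case: (sbr_derivation_l (\sum_j cst (d j) * y j)) => ->.
- exact: (derivation_over_0 (sbr_derivation_l _)).
apply: eq_bigr => i _.
rewrite (big_morph (sbr _) (id1 := 0) (op1 := +%R)); last 2 first.
- by move=> u v; case: (sbr_derivation_r (cst (c i) * x i)) => ->.
- exact: (derivation_over_0 (sbr_derivation_r _)).
apply: eq_bigr => j _.
have [_ rC rM] := sbr_derivation_r (cst (c i) * x i).
have [_ lC lM] := sbr_derivation_l (y j).
by rewrite rM rC mul0r add0r lM lC mul0r add0r rmorphM mulrA [cst (d j) * _]mulrC.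
Qed.

Lemma bracketZ (c d : K) x y : sbr (cst c * x) (cst d * y) = cst (c * d) * sbr x y.
Proof.
have [_ rC rM] := sbr_derivation_r (cst c * x).
have [_ lC lM] := sbr_derivation_l y.
by rewrite rM rC mul0r add0r lM lC mul0r add0r rmorphM mulrA [cst d * _]mulrC.
Qed.

End Equivariance.

Lemma tc_congr (g h : 'M[K]_N) (f : {rmorphism B -> B}) :
    (forall a, map_mx f (rep_mx a) = map_mx cst h *m rep_mx a *m map_mx cst g) ->
  (forall a i j, f (X a i j) =
    \sum_(t : 'I_N * 'I_N) cst (h i t.1 * g t.2 j) * X a t.1 t.2) /\
  (forall d u v w z, f (tc d u v w z) =
    \sum_(t : 'I_N * 'I_N) \sum_(t' : 'I_N * 'I_N)
      cst ((h u t.1 * g t.2 v) * (h w t'.1 * g t'.2 z)) * tc d t.1 t.2 t'.1 t'.2).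
Proof.
move=> fX; have fE a i j : f (X a i j) =
    \sum_(t : 'I_N * 'I_N) cst (h i t.1 * g t.2 j) * X a t.1 t.2.
  have /matrixP/(_ i j) := fX a; rewrite !mxE => ->.
  transitivity (\sum_q \sum_p cst (h i p) * X a p q * cst (g q j)).
    apply: eq_bigr => q _; rewrite !mxE [LHS]mulr_suml.
    by apply: eq_bigr => p _; rewrite !mxE.
  rewrite [LHS]exchange_big [LHS]pair_big; apply: eq_bigr => -[p q] _ /=.
  by rewrite rmorphM mulrAC.
split=> // d u v w z.
move: d; apply: tlift_ext => [x y|x y|a b].
- by rewrite tcD rmorphD.
- rewrite -big_split; apply: eq_bigr => t _; rewrite -big_split.
  by apply: eq_bigr => t' _; rewrite tcD mulrDr.
rewrite tc_tens rmorphM !fE big_distrlr; apply: eq_bigr => t _.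
by apply: eq_bigr => t' _; rewrite tc_tens [in RHS]rmorphM mulrACA.
Qed.

Lemma standard_bracket_congr (dbr : A -> A -> tensor A A) (sbr : B -> B -> B)
    (g h : 'M[K]_N) (f : {rmorphism B -> B}) :
    (forall x, derivation_over cst (sbr x)) ->
    (forall y, derivation_over cst (sbr^~ y)) ->
    (forall a i j b k l, sbr (X a i j) (X b k l) = tc (dbr a b) k j i l) ->
    (forall a, map_mx f (rep_mx a) = map_mx cst h *m rep_mx a *m map_mx cst g) ->
  forall a i j b k l, sbr (f (X a i j)) (f (X b k l)) = f (sbr (X a i j) (X b k l)).
Proof.
move=> sr sl sX fX a i j b k l; have [fE fT] := tc_congr fX.
rewrite !fE bracket_sum // sX fT !pair_big /=.
(* The bracket pairs the row index of [b] with the column index of [a], so the two double sums match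
   after their row indices are exchanged. *)
pose swap (t : ('I_N * 'I_N) * ('I_N * 'I_N)) := ((t.2.1, t.1.2), (t.1.1, t.2.2)).
have swapK : involutive swap by case=> [[p q] [r s]].
rewrite [LHS](reindex_inj (can_inj swapK)); apply: eq_bigr => -[[p q] [r s]] _ /=.
rewrite sX; congr (cst _ * _).
by rewrite mulrACA [h i r * _]mulrC mulrACA.
Qed.

End MatrixCoordinates.

(** * The fixed locus of the involution *)

Section StarLinear.
Variables (n : nat) (alpha : 'I_n -> nat) (R : comPzRingType).
Local Notation N := (\sum_s alpha s)%N.
Hypothesis alpha_even : forall s, ~~ odd (alpha s).

Lemma sp_star_linear c (x y : 'M[R]_N) :
  sp_star (c *: x + y) = c *: sp_star x + sp_star y.
Proof.
by rewrite !sp_star_def linearD linearZ /= mulmxDr mulmxDl -scalemxAr -scalemxAl.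
Qed.

Lemma sp_star_idem s : sp_star (idem_mx alpha R s) = idem_mx alpha R s.
Proof.
apply/matrixP => i j; rewrite sp_starE // !mxE.
rewrite (inj_eq (can_inj (tauK alpha_even))) sig1_tau eq_sym.
case: eqP => [->|_] /=; last by rewrite mulr0.
by case: eqP => _; rewrite ?mulr0 // mulr1 sgn_mul_self.
Qed.

End StarLinear.

Section FixedLocus.
Variables (K : fieldType) (A : algType K) (n : nat) (e : 'I_n -> A).
Variables (alpha : 'I_n -> nat) (phi : A -> A).
Local Notation N := (\sum_s alpha s)%N.
Local Notation B := (rep_ring e alpha).
Local Notation Q := (symrep_ring e alpha phi).
Local Notation cst := (rep_cst e alpha).
Local Notation X := (@rep_coord K A n e alpha).
Local Notation tc := (@rep_tensor_coord K A n e alpha).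
Local Notation rep_mx := (@rep_mx K A n e alpha).
Local Notation qcst := (symrep_cst e alpha phi).
Local Notation pr := (ring_proj (@symrep_relation K A n e alpha phi)).

Hypothesis phi_linear : linear phi.
Hypothesis phi_anti : forall a b, phi (a * b) = phi b * phi a.
Hypothesis phi_invol : forall a, phi (phi a) = a.
Hypothesis phi_e : forall s, phi (e s) = e s.
Hypothesis alpha_even : forall s, ~~ odd (alpha s).

(** Both [phi] and [sp_star] reverse products, so that together they preserve them. *)
Lemma rep_involution : {th : {rmorphism B -> B} | (forall k, th (cst k) = cst k) &
  forall a, map_mx th (rep_mx a) = sp_star (rep_mx (phi a))}.
Proof.
apply: (@rep_lift_mx K A n e alpha B cst (fun a => sp_star (rep_mx (phi a)))).
- by move=> k a b; rewrite phi_linear rep_mx_linear sp_star_linear.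
- by move=> a b; rewrite phi_anti rep_mxM sp_starM.
- by move=> s; rewrite phi_e rep_mx_idem sp_star_idem.
Qed.

Lemma map_pr_rep_mx a : map_mx pr (rep_mx a) = mx_coord e alpha phi a.
Proof. by apply/matrixP => i j; rewrite !mxE. Qed.

Variable th : {rmorphism B -> B}.
Hypothesis th_cst : forall k, th (cst k) = cst k.
Hypothesis th_mx : forall a, map_mx th (rep_mx a) = sp_star (rep_mx (phi a)).

Lemma th_coord a i j :
  th (X a i j) = cst (sgn K i * sgn K j) * X (phi a) (tau j) (tau i).
Proof.
have /matrixP/(_ i j) := th_mx a; rewrite sp_starE // !mxE => ->.
by rewrite rmorphM !rmorph_sgn.
Qed.

Lemma thK : involutive th.
Proof.
move=> x; apply: (rep_rmorphism_ext (f := th \o th) (g := idfun)) => [k|a] /=.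
  by rewrite !th_cst.
rewrite map_mx_comp th_mx map_sp_star // th_mx phi_invol sp_starK //.
by apply/matrixP => i j; rewrite [RHS]mxE.
Qed.

(** Every [x - th x] lies in the ideal of the fixed locus; conversely [symrep_relationP] writes the
    generators of that ideal in this form. *)
Lemma pr_th x : pr (th x) = pr x.
Proof.
apply: (rep_rmorphism_ext (f := pr \o th) (g := pr)) => [k|a] /=.
  by rewrite th_cst.
rewrite map_mx_comp th_mx map_sp_star // !map_pr_rep_mx.
by rewrite -[in RHS](phi_invol a) [RHS]mx_coord_phi // sp_star_def.
Qed.

Lemma symrep_relationP x :
  @symrep_relation K A n e alpha phi x -> exists y, x = y - th y.
Proof.
case=> a i j; exists (X (phi a) i j); congr (_ - _).
by rewrite th_coord phi_invol rmorphM !rmorph_sgn.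
Qed.

Lemma symrep_rmorphism (T : comPzRingType) (f : {rmorphism B -> T}) :
    (forall x, f (th x) = f x) ->
  {F : {rmorphism Q -> T} | forall x, F (pr x) = f x}.
Proof.
move=> fth; apply: ring_quot_rmorphism => x /symrep_relationP[y ->].
by rewrite rmorphB fth subrr.
Qed.

(** Compatibility of [D] with [th] is asked only after projection, which is enough to preserve the
    ideal. *)
Lemma pr_derivation_rel (D : B -> B) : derivation_over cst D ->
    (forall x, pr (D (th x)) = pr (D x)) ->
  forall x y, pr x = pr y -> pr (D x) = pr (D y).
Proof.
move=> DD Dth x y xy; have [DA _ DM] := DD.
apply/eqP; rewrite -subr_eq0 -rmorphB -(derivation_over_opp _ DD) -DA; apply/eqP.
apply: (ideal_span_le (rel := @symrep_relation K A n e alpha phi)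
  (F := fun x => pr (D x)) _ _ (x := x - y)).
- by move=> u v; rewrite DA rmorphD.
(* In [D (u * v)], the term [D u * v] dies because [v] is in the ideal, and [u * D v] because
   [v = w - th w]. *)
- move=> u v v_rel; have [w wE] := symrep_relationP v_rel.
  have pv0 : pr v = 0 by rewrite wE rmorphB /= pr_th subrr.
  rewrite DM rmorphD !rmorphM /= pv0 mulr0 add0r wE DA (derivation_over_opp _ DD).
  by rewrite rmorphB /= Dth subrr mulr0.
- exact/ring_projP.
Qed.

Lemma symrep_derivation (D : B -> B) : derivation_over cst D ->
    (forall x, pr (D (th x)) = pr (D x)) ->
  {D' : Q -> Q | derivation_over qcst D' & forall x, D' (pr x) = pr (D x)}.
Proof.
move=> DD Dth; pose D' (q : Q) := pr (D (ring_repr q)).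
have D'E x : D' (pr x) = pr (D x).
  by apply: pr_derivation_rel => //; rewrite ring_reprK.
have [DA DC DM] := DD.
exists D' => //; split=> [p q|k|p q].
- have [[x ->] [y ->]] := (ring_proj_surj p, ring_proj_surj q).
  by rewrite -rmorphD !D'E DA rmorphD.
- by rewrite /symrep_cst D'E DC rmorph0.
- have [[x ->] [y ->]] := (ring_proj_surj p, ring_proj_surj q).
  by rewrite -rmorphM !D'E DM rmorphD !rmorphM.
Qed.

Lemma is_derivationP (D : Q -> Q) : is_derivation D <-> derivation_over qcst D.
Proof.
split=> [[DL DM]|DD]; last first.
  split=> [c x y|]; last by case: DD.
  by case: (DD) => DA _ _; rewrite DA !symrep_scaleE (derivation_overZ _ _ DD).
have D1 : D 1 = 0.
  by apply: (addrI (D 1)); rewrite addr0 -[in RHS](mulr1 1) DM mulr1 mul1r.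
have DA x y : D (x + y) = D x + D y.
  by have := DL 1 x y; rewrite !scale1r.
have D0 : D 0 = 0 by apply: (addrI (D 0)); rewrite -DA !addr0.
split=> // k; have := DL k 1 0; rewrite addr0 D0 addr0 D1 !symrep_scaleE.
by rewrite mulr1 mulr0.
Qed.

Lemma symrep_generated : generated_over qcst
  (fun t : A * 'I_N * 'I_N => symrep_coord e phi t.1.1 t.1.2 t.2).
Proof.
move=> P PC PX PD PM q; have [x ->] := ring_proj_surj q.
elim/(@rep_generated K A n e alpha): x => [k|t|x y Px Py|x y Px Py].
- exact: PC.
- exact: PX.
- by rewrite rmorphD; exact: PD.
- by rewrite rmorphM; exact: PM.
Qed.

Lemma tensor_coord_pr d u v w z : tensor_coord e phi d u v w z = pr (tc d u v w z).
Proof.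
have QB : is_bilinear (fun d1 d2 : A =>
    symrep_coord e phi d1 u v * symrep_coord e phi d2 w z).
  split=> [b c a a'|b c a a'] /=; rewrite coord_linear !symrep_scaleE.
    by rewrite mulrDl mulrA.
  by rewrite mulrDr mulrCA.
move: d; apply: tlift_ext => [x y|x y|a b].
- exact: tliftD QB x y.
- by rewrite tcD rmorphD.
- by rewrite tc_tens rmorphM; exact: tlift_tens QB a b.
Qed.

End FixedLocus.

Lemma addr_half (K : fieldType) : 2%:R != 0 :> K -> 2%:R^-1 + 2%:R^-1 = 1 :> K.
Proof. by move=> two0; apply: (mulfI two0); rewrite mulrDr mulfV // mulr1. Qed.

(** * Descent of the bracket *)

Section BracketOnFixedLocus.
Variables (K : fieldType) (A : algType K) (n : nat) (e : 'I_n -> A).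
Variables (alpha : 'I_n -> nat) (phi : A -> A).
Local Notation N := (\sum_s alpha s)%N.
Local Notation B := (rep_ring e alpha).
Local Notation Q := (symrep_ring e alpha phi).
Local Notation cst := (rep_cst e alpha).
Local Notation X := (@rep_coord K A n e alpha).
Local Notation tc := (@rep_tensor_coord K A n e alpha).
Local Notation rep_mx := (@rep_mx K A n e alpha).
Local Notation qcst := (symrep_cst e alpha phi).
Local Notation pr := (ring_proj (@symrep_relation K A n e alpha phi)).

Lemma antisymmetric_biderivation_ext (br br' : Q -> Q -> Q) :
    antisymmetric_biderivation br -> antisymmetric_biderivation br' ->
    (forall a i j b k l,
       br (symrep_coord e phi a i j) (symrep_coord e phi b k l) =
       br' (symrep_coord e phi a i j) (symrep_coord e phi b k l)) ->
  br = br'.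
Proof.
move=> [brC brD] [br'C br'D] eqX; apply/funext => x; apply/funext => y.
pose ext := derivation_over_ext (@symrep_generated K A n e alpha phi).
have bD z : derivation_over qcst (br z) by apply/is_derivationP.
have b'D z : derivation_over qcst (br' z) by apply/is_derivationP.
move: y; apply: (ext _ (br' x)) => // -[[b k] l] /=.
rewrite brC [RHS]br'C; congr (- _); move: x.
by apply: (ext _ (br' (symrep_coord e phi b k l))).
Qed.

Hypothesis phi_linear : linear phi.
Hypothesis phi_invol : forall a, phi (phi a) = a.
Hypothesis alpha_even : forall s, ~~ odd (alpha s).

Variable th : {rmorphism B -> B}.
Hypothesis th_cst : forall k, th (cst k) = cst k.
Hypothesis th_mx : forall a, map_mx th (rep_mx a) = sp_star (rep_mx (phi a)).

Let th_X := th_coord alpha_even th_mx.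
Let th_K := thK phi_invol alpha_even th_cst th_mx.
Let prth := pr_th phi_invol alpha_even th_cst th_mx.
Let pr_rel := pr_derivation_rel phi_invol alpha_even th_cst th_mx.

Lemma tc_th d u v w z : th (tc d u v w z) =
  cst (sgn K u * sgn K v * (sgn K w * sgn K z)) *
    tc (tmap phi d) (tau v) (tau u) (tau z) (tau w).
Proof.
move: d; apply: tlift_ext => [x y|x y|a b].
- by rewrite tcD rmorphD.
- by rewrite tmapD // tcD mulrDr.
- rewrite tmap_tens // [in LHS]tc_tens [in RHS]tc_tens.
  by rewrite rmorphM !th_X mulrACA -rmorphM.
Qed.

Variable dbr : A -> A -> tensor A A.
Hypothesis dbr_bracket : double_bracket e dbr.
Hypothesis dbr_jacobi : forall a b c, double_jacobiator dbr a b c = 0.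
Hypothesis phi_dbr : forall a b, tmap phi (dbr a b) = tswap (dbr (phi a) (phi b)).

Variable sbr : B -> B -> B.
Hypothesis sbr_derivation_r : forall x, derivation_over cst (sbr x).
Hypothesis sbr_derivation_l : forall y, derivation_over cst (sbr^~ y).
Hypothesis sbr_coord : forall a i j b k l,
  sbr (X a i j) (X b k l) = tc (dbr a b) k j i l.

(** On coordinates, [th] transposes both index pairs, which crosses the rows and columns of [a] and
    [b]; the swap in the compatibility of [phi] with the double bracket undoes this. Each of the
    four signs occurs once on either side. *)
Lemma sbr_th x y : th (sbr x y) = sbr (th x) (th y).
Proof.
apply: (bracket_equivariant sbr_derivation_r sbr_derivation_l th_K th_K th_cst).
move=> a i j b k l; rewrite !th_X bracketZ // sbr_coord [in RHS]sbr_coord.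
rewrite tc_th phi_dbr tc_tswap; congr (cst _ * _).
by rewrite [LHS]mulrACA [sgn K i * sgn K k]mulrC [LHS]mulrACA.
Qed.

Hypothesis two_neq0 : 2%:R != 0 :> K.

(** The projection onto the invariants of [th]. *)
Definition th_mean x : B := cst 2%:R^-1 * (x + th x).

Lemma th_th_mean x : th (th_mean x) = th_mean x.
Proof. by rewrite rmorphM rmorphD th_cst /= th_K addrC. Qed.

Lemma pr_th_mean x : pr (th_mean x) = pr x.
Proof.
have half : cst 2%:R^-1 + cst 2%:R^-1 = 1.
  by rewrite -rmorphD addr_half // rmorph1.
rewrite rmorphM rmorphD /= prth mulrDr -mulrDl.
by rewrite -(rmorphD pr) half rmorph1 mul1r.
Qed.

Lemma pr_sbr_th x y : pr (sbr (th_mean x) (th y)) = pr (sbr (th_mean x) y).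
Proof. by rewrite -[in LHS](th_th_mean x) -sbr_th prth. Qed.

Lemma pr_sbr_rel_r x y y' : pr y = pr y' ->
  pr (sbr (th_mean x) y) = pr (sbr (th_mean x) y').
Proof. by move=> yy'; apply: pr_rel => // z; exact: pr_sbr_th. Qed.

(** Averaging the right argument as well does not change the class, and the bracket of two averages
    is antisymmetric already before projection. *)
Lemma pr_sbr_antisym x y : pr (sbr (th_mean x) y) = - pr (sbr (th_mean y) x).
Proof.
rewrite (pr_sbr_rel_r x (esym (pr_th_mean y))) (pr_sbr_rel_r y (esym (pr_th_mean x))).
by rewrite -rmorphN; congr (pr _); exact: (sbr_antisym dbr_bracket).
Qed.

Lemma pr_sbr_rel_l x x' y : pr x = pr x' ->
  pr (sbr (th_mean x) y) = pr (sbr (th_mean x') y).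
Proof.
by move=> xx'; rewrite pr_sbr_antisym (pr_sbr_rel_r y xx') -pr_sbr_antisym.
Qed.

Lemma symrep_bracket : {br : Q -> Q -> Q | poisson_bracket br &
  forall x y, br (pr x) (pr y) = pr (sbr (th_mean x) y)}.
Proof.
have D x := symrep_derivation phi_invol alpha_even th_cst th_mx
  (sbr_derivation_r (th_mean x)) (pr_sbr_th x).
pose br (p q : Q) := s2val (D (ring_repr p)) q.
have brD p : derivation_over qcst (br p) by exact: s2valP (D (ring_repr p)).
have brE x y : br (pr x) (pr y) = pr (sbr (th_mean x) y).
  rewrite [LHS](s2valP' (D (ring_repr (pr x))) y).
  by apply: pr_sbr_rel_l; exact: ring_reprK.
exists br => //; split; first split=> [p q|p].
- have [[x ->] [y ->]] := (ring_proj_surj p, ring_proj_surj q).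
  by rewrite !brE pr_sbr_antisym.
- by apply/is_derivationP.
move=> p q r; have [x ->] := ring_proj_surj p.
have [[y ->] [z ->]] := (ring_proj_surj q, ring_proj_surj r).
(* With all three arguments averaged, nested brackets are classes of nested brackets upstairs, and
   the Jacobi identity there projects. *)
have br2 u v w : br (pr u) (br (pr v) (pr w)) =
    pr (sbr (th_mean u) (sbr (th_mean v) (th_mean w))).
  by rewrite (brE v w) (pr_sbr_rel_r v (esym (pr_th_mean w))) brE.
have := congr1 pr (sbr_jacobi dbr_bracket sbr_derivation_r sbr_derivation_l
  sbr_coord dbr_jacobi (th_mean x) (th_mean y) (th_mean z)).
by rewrite /jacobiator !(rmorphD pr) (rmorph0 pr) /= -!br2.
Qed.

Variable br : Q -> Q -> Q.
Hypothesis brE : forall x y, br (pr x) (pr y) = pr (sbr (th_mean x) y).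

Lemma symrep_bracket_formula : phi_Sp_formula dbr br.
Proof.
move=> a b i j k l; rewrite !tensor_coord_pr !symrep_scaleE.
rewrite [LHS](brE (X a i j) (X b k l)) /th_mean th_X.
rewrite (derivation_overZ _ _ (sbr_derivation_l _)).
case: (sbr_derivation_l (X b k l)) => -> _ _.
rewrite (derivation_overZ _ _ (sbr_derivation_l _)) !sbr_coord.
by rewrite mulrDr mulrA -rmorphM rmorphD !rmorphM.
Qed.

Lemma symrep_bracket_equivariant (f : {rmorphism B -> B}) (F : {rmorphism Q -> Q}) :
    (forall k, f (cst k) = cst k) -> (forall x, f (th x) = th (f x)) ->
    (forall x y, f (sbr x y) = sbr (f x) (f y)) ->
    (forall x, F (pr x) = pr (f x)) ->
  forall p q, F (br p q) = br (F p) (F q).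
Proof.
move=> fC fth fbr FE p q; have [x ->] := ring_proj_surj p.
have [y ->] := ring_proj_surj q; rewrite !(brE, FE) fbr; congr (pr (sbr _ _)).
by rewrite /th_mean rmorphM rmorphD /= fC fth.
Qed.

End BracketOnFixedLocus.

(** * Symplectic actions and moment maps *)

Section SymplecticGroup.
Variables (K : fieldType) (n : nat) (alpha : 'I_n -> nat).
Local Notation N := (\sum_s alpha s)%N.
Hypothesis alpha_even : forall s, ~~ odd (alpha s).
Implicit Types g h : 'M[K]_N.

Lemma sp_star_block_diagonal g : block_diagonal g -> block_diagonal (sp_star g).
Proof.
by move=> gd i j ij; rewrite sp_starE // gd ?mulr0 // !sig1_tau eq_sym.
Qed.

Lemma Sp_groupP g : Sp_group g ->
  [/\ sp_star g *m g = 1%:M, g *m sp_star g = 1%:M & block_diagonal g].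
Proof.
by move=> /(Sp_group_mul_star alpha_even)[gg gd]; split=> //; exact: mulmx1C.
Qed.

Lemma Sp_group_inv g : Sp_group g -> invmx g = sp_star g.
Proof.
move=> /Sp_groupP[gg gg' _]; have [_ gU] := mulmx1_unit gg.
by rewrite -[LHS]mul1mx -gg mulmxK.
Qed.

Lemma Sp_group1 : Sp_group (1%:M : 'M[K]_N).
Proof.
exists (fun=> 1%:M); last by rewrite mxdiagZ.
by move=> s; rewrite trmx1 mul1mx mulmx1.
Qed.

Lemma Sp_groupM g h : Sp_group g -> Sp_group h -> Sp_group (g *m h).
Proof.
case=> u uO -> [v vO ->]; exists (fun s => u s *m v s); last exact: mul_mxdiag.
move=> s; rewrite trmx_mul.
transitivity ((v s)^T *m ((u s)^T *m Omega K (alpha s) *m u s) *m v s).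
  by rewrite !mulmxA.
by rewrite uO vO.
Qed.

End SymplecticGroup.

Section Actions.
Variables (K : fieldType) (A : algType K) (n : nat) (e : 'I_n -> A).
Variables (alpha : 'I_n -> nat) (phi : A -> A).
Local Notation N := (\sum_s alpha s)%N.
Local Notation B := (rep_ring e alpha).
Local Notation Q := (symrep_ring e alpha phi).
Local Notation cst := (rep_cst e alpha).
Local Notation X := (@rep_coord K A n e alpha).
Local Notation tc := (@rep_tensor_coord K A n e alpha).
Local Notation rep_mx := (@rep_mx K A n e alpha).
Local Notation qcst := (symrep_cst e alpha phi).
Local Notation pr := (ring_proj (@symrep_relation K A n e alpha phi)).
Local Notation XQ := (mx_coord e alpha phi).
Local Notation cmx := (map_mx cst).

Lemma map_cmx (f : {rmorphism B -> B}) (g : 'M[K]_N) :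
  (forall k, f (cst k) = cst k) -> map_mx f (cmx g) = cmx g.
Proof. by move=> fC; apply/matrixP => i j; rewrite !mxE fC. Qed.

Lemma map_pr_cmx (g : 'M[K]_N) : map_mx pr (cmx g) = cst_mx e phi g.
Proof. by apply/matrixP => i j; rewrite !mxE. Qed.

(** Block-diagonality makes the conjugation fix the matrices of the idempotents, which the relations
    prescribe. *)
Lemma rep_conj (g h : 'M[K]_N) :
    h *m g = 1%:M -> g *m h = 1%:M -> block_diagonal g ->
  {f : {rmorphism B -> B} | (forall k, f (cst k) = cst k) &
    forall a, map_mx f (rep_mx a) = cmx h *m rep_mx a *m cmx g}.
Proof.
move=> hg gh gd; have hg1 : cmx h *m cmx g = 1%:M by rewrite -map_mxM hg map_mx1.
have gh1 : cmx g *m cmx h = 1%:M by rewrite -map_mxM gh map_mx1.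
apply: (@rep_lift_mx K A n e alpha B cst (fun a => cmx h *m rep_mx a *m cmx g)).
- move=> k a b; rewrite rep_mx_linear mulmxDr mulmxDl.
  by rewrite -scalemxAr -scalemxAl.
- by move=> a b; rewrite rep_mxM -!mulmxA [cmx g *m (cmx h *m _)]mulmxA gh1 mul1mx.
- move=> s; rewrite rep_mx_idem -mulmxA.
  by rewrite -(block_diagonal_comm s (map_block_diagonal cst gd)) mulmxA hg1 mul1mx.
Qed.

Hypothesis phi_linear : linear phi.
Hypothesis phi_invol : forall a, phi (phi a) = a.
Hypothesis alpha_even : forall s, ~~ odd (alpha s).

Variable th : {rmorphism B -> B}.
Hypothesis th_cst : forall k, th (cst k) = cst k.
Hypothesis th_mx : forall a, map_mx th (rep_mx a) = sp_star (rep_mx (phi a)).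
Let th_K := thK phi_invol alpha_even th_cst th_mx.
Let prth := pr_th phi_invol alpha_even th_cst th_mx.

(** With the inverse written as [sp_star g], applying [sp_star] to a conjugate exchanges the two
    outer factors and conjugates the adjoint by the same [g]. *)
Lemma rep_conj_th (g : 'M[K]_N) (f : {rmorphism B -> B}) :
    (forall k, f (cst k) = cst k) ->
    (forall a, map_mx f (rep_mx a) = cmx (sp_star g) *m rep_mx a *m cmx g) ->
  forall x, f (th x) = th (f x).
Proof.
move=> fC fX; apply: (rep_rmorphism_ext (f := f \o th) (g := th \o f)) => [k|a] /=.
  by rewrite fC !th_cst fC.
have starG : sp_star (cmx g) = cmx (sp_star g) by rewrite map_sp_star.
have starH : sp_star (cmx (sp_star g)) = cmx g by rewrite -starG sp_starK.
transitivity (cmx (sp_star g) *m sp_star (rep_mx (phi a)) *m cmx g).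
  rewrite map_mx_comp th_mx map_sp_star // fX.
  by rewrite sp_starM // [sp_star (_ *m rep_mx _)]sp_starM // starG starH mulmxA.
rewrite [RHS]map_mx_comp fX [RHS]map_mxM; congr (_ *m _); last by rewrite map_cmx.
by rewrite [RHS]map_mxM; congr (_ *m _); [rewrite map_cmx|rewrite th_mx].
Qed.

Variable dbr : A -> A -> tensor A A.
Variable sbr : B -> B -> B.
Hypothesis sbr_derivation_r : forall x, derivation_over cst (sbr x).
Hypothesis sbr_derivation_l : forall y, derivation_over cst (sbr^~ y).
Hypothesis sbr_coord : forall a i j b k l,
  sbr (X a i j) (X b k l) = tc (dbr a b) k j i l.
Variable br : Q -> Q -> Q.
Hypothesis brE : forall x y, br (pr x) (pr y) = pr (sbr (th_mean th x) y).

Lemma symrep_action (g : 'M[K]_N) : Sp_group g ->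
  {F : {rmorphism Q -> Q} |
    (forall k, F (qcst k) = qcst k) /\
    (forall p q, F (br p q) = br (F p) (F q)) &
    forall a, map_mx F (XQ a) = cst_mx e phi (sp_star g) *m XQ a *m cst_mx e phi g}.
Proof.
move=> /(Sp_groupP alpha_even)[hg gh gd].
have hd := sp_star_block_diagonal alpha_even gd.
have [f fC fX] := rep_conj hg gh gd; have [f' f'C f'X] := rep_conj gh hg hd.
have fth := rep_conj_th fC fX.
(* Equivariance of the bracket asks for an inverse morphism, which is conjugation by the inverse
   matrix. *)
have cancel_conj (f1 f2 : {rmorphism B -> B}) g1 g2 :
    (forall k, f1 (cst k) = cst k) -> (forall k, f2 (cst k) = cst k) ->
    (forall a, map_mx f1 (rep_mx a) = cmx g1 *m rep_mx a *m cmx g2) ->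
    (forall a, map_mx f2 (rep_mx a) = cmx g2 *m rep_mx a *m cmx g1) ->
    g1 *m g2 = 1%:M -> cancel f1 f2.
  move=> f1C f2C f1X f2X g12 x.
  apply: (rep_rmorphism_ext (f := f2 \o f1) (g := idfun)) => [k|a] /=.
    by rewrite f1C f2C.
  rewrite map_mx_comp f1X !map_mxM !map_cmx // f2X !mulmxA -map_mxM g12 map_mx1.
  rewrite mul1mx -mulmxA -map_mxM g12 map_mx1 mulmx1.
  by apply/matrixP => i j; rewrite [RHS]mxE.
have fK : cancel f f' by exact: cancel_conj hg.
have f'K : cancel f' f by exact: cancel_conj gh.
have fbr := bracket_equivariant sbr_derivation_r sbr_derivation_l fK f'K fC
  (standard_bracket_congr sbr_derivation_r sbr_derivation_l sbr_coord fX).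
have [x|F FE] := symrep_rmorphism phi_invol alpha_even th_mx (f := pr \o f) => /=.
  by rewrite fth prth.
exists F; first split.
- by move=> k; rewrite /symrep_cst FE /= fC.
- exact: symrep_bracket_equivariant fC fth fbr FE.
move=> a; rewrite -map_pr_rep_mx -!map_pr_cmx -!map_mxM -fX.
by apply/matrixP => i j; rewrite !mxE FE.
Qed.

Lemma rep_infinitesimal (xi : 'M[K]_N) : block_diagonal xi ->
  {D : B -> B | derivation_over cst D &
    forall a, map_mx D (rep_mx a) = rep_mx a *m cmx xi - cmx xi *m rep_mx a}.
Proof.
move=> xd.
apply: (@rep_derivation_mx K A n e alpha
  (fun a => rep_mx a *m cmx xi - cmx xi *m rep_mx a)).
- move=> k a b; rewrite rep_mx_linear mulmxDr mulmxDl -scalemxAr -scalemxAl.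
  by rewrite opprD addrACA scalerBr.
- move=> a b; rewrite rep_mxM mulmxBl mulmxBr !mulmxA.
  by rewrite [RHS]addrC addrA subrK.
- move=> s; rewrite rep_mx_idem.
  by rewrite (block_diagonal_comm s (map_block_diagonal cst xd)) subrr.
Qed.

Lemma derivation_sp_star (D : B -> B) (x : 'M[B]_N) : derivation_over cst D ->
  map_mx D (sp_star x) = sp_star (map_mx D x).
Proof.
move=> DD; apply/matrixP => i j; rewrite mxE !sp_starE // mxE.
by rewrite -!(rmorph_sgn cst) -rmorphM (derivation_overZ _ _ DD).
Qed.

(** [sp_star] reverses the commutator with [xi]; the resulting sign is cancelled by that of
    [sp_star xi = - xi]. *)
Lemma rep_infinitesimal_th (xi : 'M[K]_N) (D : B -> B) :
    sp_star xi = - xi -> derivation_over cst D ->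
    (forall a, map_mx D (rep_mx a) = rep_mx a *m cmx xi - cmx xi *m rep_mx a) ->
  forall x, D (th x) = th (D x).
Proof.
(* The claim is recast as [th (D (th x)) = D x], an equality of two derivations, to be checked on
   coordinates. *)
move=> xs DD DX x; rewrite -[LHS]th_K; congr (th _); move: x.
apply: rep_derivation_ext => [|//|a].
  exact: (derivation_over_conj th_K th_cst DD).
have -> : map_mx (fun x => th (D (th x))) (rep_mx a) =
    map_mx th (map_mx D (map_mx th (rep_mx a))).
  by apply/matrixP => i j; rewrite !mxE.
have thmxK : map_mx th (map_mx th (rep_mx a)) = rep_mx a.
  by apply/matrixP => i j; rewrite !mxE th_K.
rewrite th_mx derivation_sp_star // DX sp_starB // !sp_starM //.
rewrite -!(map_sp_star cst) // xs -th_mx map_mxN mulNmx mulmxN opprK addrC.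
by rewrite DX map_mxB !map_mxM thmxK map_cmx.
Qed.

(** The clause ranges over all lifts [D] because the lift used in the construction is hidden; the
    moment map property can then bring its own. *)
Lemma symrep_infinitesimal (xi : 'M[K]_N) : sp_algebra xi ->
  {D' : Q -> Q | is_derivation D' /\
    (forall D : B -> B, derivation_over cst D ->
      (forall a, map_mx D (rep_mx a) = rep_mx a *m cmx xi - cmx xi *m rep_mx a) ->
      forall x, D' (pr x) = pr (D x)) &
    forall a, map_mx D' (XQ a) = XQ a *m cst_mx e phi xi - cst_mx e phi xi *m XQ a}.
Proof.
move=> /(sp_algebraP alpha_even)[xs xd]; have [D DD DX] := rep_infinitesimal xd.
have [x|D' D'D D'E] := symrep_derivation phi_invol alpha_even th_cst th_mx DD.
  by rewrite (rep_infinitesimal_th xs DD DX) prth.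
exists D'; first split; first exact/is_derivationP.
  move=> D2 D2D D2X x; rewrite D'E; congr (pr _); move: x.
  by apply: rep_derivation_ext => // a; rewrite DX D2X.
move=> a; rewrite -map_pr_rep_mx -!map_pr_cmx -!map_mxM -map_mxB -DX.
by apply/matrixP => i j; rewrite !mxE D'E.
Qed.

End Actions.

Lemma mxtrace_sp_star (n : nat) (alpha : 'I_n -> nat) (R : comPzRingType)
    (alpha_even : forall s, ~~ odd (alpha s)) (x : 'M[R]_(\sum_s alpha s)) :
  \tr (sp_star x) = \tr x.
Proof.
rewrite sp_star_def mxtrace_mulC mulmxA mul_tr_block_Omega // mul1mx.
exact: mxtrace_tr.
Qed.

(** * The moment map *)

Section MomentMap.
Variables (K : fieldType) (A : algType K) (n : nat) (e : 'I_n -> A).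
Variables (alpha : 'I_n -> nat) (phi : A -> A).
Local Notation N := (\sum_s alpha s)%N.
Local Notation B := (rep_ring e alpha).
Local Notation Q := (symrep_ring e alpha phi).
Local Notation cst := (rep_cst e alpha).
Local Notation X := (@rep_coord K A n e alpha).
Local Notation tc := (@rep_tensor_coord K A n e alpha).
Local Notation rep_mx := (@rep_mx K A n e alpha).
Local Notation pr := (ring_proj (@symrep_relation K A n e alpha phi)).
Local Notation XQ := (mx_coord e alpha phi).
Local Notation cmx := (map_mx cst).

Lemma rep_mxD a b : rep_mx (a + b) = rep_mx a + rep_mx b.
Proof. by have := rep_mx_linear e alpha 1 a b; rewrite rmorph1 !scale1r. Qed.

Lemma rep_mx0 : rep_mx 0 = 0.
Proof. by apply: (addrI (rep_mx 0)); rewrite -rep_mxD !addr0. Qed.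

Lemma rep_mxN a : rep_mx (- a) = - rep_mx a.
Proof. by apply: (addrI (rep_mx a)); rewrite -rep_mxD !subrr rep_mx0. Qed.

Variables (dbr : A -> A -> tensor A A) (mu : A).
Hypothesis dbr_bracket : double_bracket e dbr.
Hypothesis mu_moment : is_double_moment_map e dbr mu.

Lemma rep_mx_moment_block : block_diagonal (rep_mx mu).
Proof.
case: mu_moment => mus [-> musE _] i j ij.
have sumE (r : seq 'I_n) :
    rep_mx (\sum_(s <- r) mus s) = \sum_(s <- r) rep_mx (mus s).
  exact: (big_morph _ rep_mxD rep_mx0).
rewrite sumE summxE big1 // => s _; have [y ->] := musE s.
rewrite !rep_mxM rep_mx_idem mul_mx_idem mul_idem_mx.
by case: eqP => // <-; rewrite (negPf ij).
Qed.

Lemma dbr_moment b : dbr mu b =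
  \sum_s (tens (b * e s) (e s) - tens (e s) (e s * b)).
Proof.
case: mu_moment => mus [-> _ musE].
have dL := dbr_linear_l dbr_bracket b.
have dD x y : dbr (x + y) b = dbr x b + dbr y b.
  by have := dL 1 x y; rewrite !scale1r.
have d0 : dbr 0 b = 0 by apply: (addrI (dbr 0 b)); rewrite -dD !addr0.
rewrite (big_morph (fun x => dbr x b) dD d0).
by apply: eq_bigr => s _; exact: musE.
Qed.

Lemma tc_sum (I : Type) (r : seq I) (F : I -> tensor A A) u v w z :
  tc (\sum_(i <- r) F i) u v w z = \sum_(i <- r) tc (F i) u v w z.
Proof.
exact: (big_morph (fun d => tc d u v w z) (fun d d' => tcD e d d' u v w z)
  (tc0 e u v w z)).
Qed.

(** Only the summand of the block containing [j] survives. Index pairs from different blocks meet a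
    zero entry of [xi] when the trace is formed. *)
Lemma tc_moment b k j i l : tagnat.sig1 i = tagnat.sig1 j ->
  tc (dbr mu b) k j i l = X b k j * (i == l)%:R - (k == j)%:R * X b i l.
Proof.
have rE s p q : X (b * e s) p q = if tagnat.sig1 q == s then X b p q else 0.
  have /matrixP/(_ p q) := rep_mxM e alpha b (e s).
  by rewrite rep_mx_idem mul_mx_idem !mxE.
have lE s p q : X (e s * b) p q = if tagnat.sig1 p == s then X b p q else 0.
  have /matrixP/(_ p q) := rep_mxM e alpha (e s) b.
  by rewrite rep_mx_idem mul_idem_mx !mxE.
move=> ij; rewrite dbr_moment tc_sum (bigD1 (tagnat.sig1 j)) //=.
rewrite [X in _ + X]big1 => [|s sj]; rewrite tcD tcN.
  rewrite addr0 [X in X - _]tc_tens [X in _ - X]tc_tens rE lE !rep_coord_idem ij eqxx.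
  rewrite andbT; case: (eqVneq k j) => [->|_]; rewrite ?eqxx /=.
    by case: eqP.
  by case: eqP => _; rewrite !mul0r.
rewrite [X in X - _]tc_tens [X in _ - X]tc_tens rE rep_coord_idem.
rewrite [X in _ - X * _]rep_coord_idem.
rewrite eq_sym (negPf sj) mul0r.
case: (eqVneq k j) => [->|_]; last by rewrite mul0r subrr.
by rewrite eq_sym (negPf sj) mul0r subrr.
Qed.

Hypothesis phi_linear : linear phi.
Hypothesis phi_invol : forall a, phi (phi a) = a.
Hypothesis alpha_even : forall s, ~~ odd (alpha s).

Variable th : {rmorphism B -> B}.
Hypothesis th_cst : forall k, th (cst k) = cst k.
Hypothesis th_mx : forall a, map_mx th (rep_mx a) = sp_star (rep_mx (phi a)).

Variable sbr : B -> B -> B.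
Hypothesis sbr_derivation_r : forall x, derivation_over cst (sbr x).
Hypothesis sbr_derivation_l : forall y, derivation_over cst (sbr^~ y).
Hypothesis sbr_coord : forall a i j b k l,
  sbr (X a i j) (X b k l) = tc (dbr a b) k j i l.

(** The two terms of [tc_moment], weighted by [xi j i] and summed, are the two products in the
    commutator of X(b) with [xi]. *)
Lemma bracket_trace_moment (xi : 'M[K]_N) (D : B -> B) : block_diagonal xi ->
    derivation_over cst D ->
    (forall a, map_mx D (rep_mx a) = rep_mx a *m cmx xi - cmx xi *m rep_mx a) ->
  forall y, sbr (\tr (rep_mx mu *m cmx xi)) y = D y.
Proof.
move=> xd DD DX; apply: rep_derivation_ext => // b.
rewrite DX; apply/matrixP => k l.
have sum_sbr y (F : 'I_N -> B) : sbr (\sum_i F i) y = \sum_i sbr (F i) y.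
  have [sD _ _] := sbr_derivation_l y.
  exact: (big_morph (sbr^~ y) sD (derivation_over_0 (sbr_derivation_l y))).
transitivity (\sum_i \sum_j cst (xi j i) *
    (X b k j * (i == l)%:R - (k == j)%:R * X b i l)).
  rewrite !mxE /mxtrace sum_sbr; apply: eq_bigr => i _.
  rewrite mxE sum_sbr; apply: eq_bigr => j _.
  rewrite !mxE mulrC (derivation_overZ _ _ (sbr_derivation_l _)) sbr_coord.
  have [ij|ij] := eqVneq (tagnat.sig1 i) (tagnat.sig1 j); first by rewrite tc_moment.
  rewrite (xd j i); last by rewrite eq_sym.
  by rewrite /= rmorph0 !mul0r.
transitivity (\sum_i (\sum_j cst (xi j i) * (X b k j * (i == l)%:R)
    - \sum_j cst (xi j i) * ((k == j)%:R * X b i l))).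
  apply: eq_bigr => i _; rewrite -sumrB.
  by apply: eq_bigr => j _; rewrite mulrBr.
rewrite sumrB !mxE; congr (_ - _).
  rewrite (bigD1 l) //= [X in _ + X]big1 => [|i il].
    by rewrite addr0; apply: eq_bigr => j _; rewrite !mxE eqxx mulr1 mulrC.
  by apply: big1 => j _; rewrite (negPf il) !mulr0.
apply: eq_bigr => i _; rewrite (bigD1 k) //= [X in _ + X]big1 => [|j jk].
  by rewrite !mxE eqxx mul1r addr0.
by rewrite eq_sym (negPf jk) mul0r mulr0.
Qed.

Hypothesis mu_phi : mu + phi mu = 0.
Let phi_mu : phi mu = - mu. Proof. by apply: (addrI mu); rewrite mu_phi subrr. Qed.

Lemma moment_sp_algebra : sp_algebra (XQ mu).
Proof.
apply/(sp_algebraP alpha_even); rewrite -map_pr_rep_mx; split; last first.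
  exact: map_block_diagonal rep_mx_moment_block.
have prth (Y : 'M[B]_N) : map_mx pr (map_mx th Y) = map_mx pr Y.
  apply/matrixP => i j; rewrite !mxE.
  exact: (pr_th phi_invol alpha_even th_cst th_mx).
have sE : sp_star (rep_mx mu) = map_mx th (- rep_mx mu).
  by rewrite -rep_mxN -phi_mu th_mx phi_invol.
transitivity (map_mx pr (sp_star (rep_mx mu))); first by rewrite map_sp_star.
by rewrite sE [LHS]prth map_mxN.
Qed.

(** Two signs cancel, one from [phi mu = - mu] and one from [xi], while the trace is unchanged by
    [sp_star]. *)
Lemma th_trace_moment (xi : 'M[K]_N) : sp_star xi = - xi ->
  th (\tr (rep_mx mu *m cmx xi)) = \tr (rep_mx mu *m cmx xi).
Proof.
move=> xs; rewrite -trace_map_mx map_mxM map_cmx // th_mx phi_mu rep_mxN.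
rewrite -(mxtrace_sp_star alpha_even) sp_starM // sp_starK // mulmxN.
by rewrite -map_sp_star // xs map_mxN mulNmx opprK mxtrace_mulC.
Qed.

Hypothesis two_neq0 : 2%:R != 0 :> K.
Variable br : Q -> Q -> Q.
Hypothesis brE : forall x y, br (pr x) (pr y) = pr (sbr (th_mean th x) y).

Lemma trace_pairing_pr (xi : 'M[K]_N) :
  trace_pairing (XQ mu) xi = pr (\tr (rep_mx mu *m cmx xi)).
Proof.
by rewrite /trace_pairing -map_pr_rep_mx -map_pr_cmx -map_mxM trace_map_mx.
Qed.

(** Averaging fixes the invariant function tr(X(mu) xi), so no factor 1/2 remains and X(mu) needs no
    rescaling. *)
Lemma symrep_bracket_moment (xi : 'M[K]_N) (D : B -> B) : sp_algebra xi ->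
    derivation_over cst D ->
    (forall a, map_mx D (rep_mx a) = rep_mx a *m cmx xi - cmx xi *m rep_mx a) ->
  forall x, br (trace_pairing (XQ mu) xi) (pr x) = pr (D x).
Proof.
move=> /(sp_algebraP alpha_even)[xs xd] DD DX x; rewrite trace_pairing_pr brE.
have -> : th_mean th (\tr (rep_mx mu *m cmx xi)) = \tr (rep_mx mu *m cmx xi).
  rewrite /th_mean th_trace_moment // mulrDr -mulrDl -(rmorphD cst).
  by rewrite addr_half // rmorph1 mul1r.
by rewrite (bracket_trace_moment xd DD DX).
Qed.

End MomentMap.

(** * Assembly of the Poisson structure *)

Section SymplecticPoissonStructure.
Variables (K : fieldType) (A : algType K) (n : nat) (e : 'I_n -> A).
Variables (alpha : 'I_n -> nat) (phi : A -> A).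
Local Notation N := (\sum_s alpha s)%N.
Local Notation Q := (symrep_ring e alpha phi).
Local Notation qcst := (symrep_cst e alpha phi).
Local Notation XQ := (mx_coord e alpha phi).
Local Notation qmx := (cst_mx e phi).

Lemma symrep_rmorphism_ext (T : pzRingType) (f g : {rmorphism Q -> T}) :
    (forall k, f (qcst k) = g (qcst k)) ->
    (forall a, map_mx f (XQ a) = map_mx g (XQ a)) ->
  f =1 g.
Proof.
move=> fgC fgX; apply: (rmorphism_ext (@symrep_generated K A n e alpha phi)) => //.
by case=> -[a i] j; have /matrixP/(_ i j) := fgX a; rewrite !mxE.
Qed.

Lemma map_qmx (f : {rmorphism Q -> Q}) (g : 'M[K]_N) :
  (forall k, f (qcst k) = qcst k) -> map_mx f (qmx g) = qmx g.
Proof. by move=> fC; apply/matrixP => i j; rewrite !mxE fC. Qed.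

Lemma qmxM (g h : 'M[K]_N) : qmx (g *m h) = qmx g *m qmx h.
Proof. exact: map_mxM. Qed.

Lemma qmx1 : qmx (1%:M : 'M[K]_N) = 1%:M.
Proof. exact: map_mx1. Qed.

Lemma qmxP c (g h : 'M[K]_N) : qmx (c *: g + h) = qcst c *: qmx g + qmx h.
Proof. by rewrite /cst_mx map_mxD map_mxZ. Qed.

Variable dbr : A -> A -> tensor A A.
Hypothesis two_neq0 : 2%:R != 0 :> K.
Hypothesis dbr_poisson : double_poisson e dbr.
Hypothesis phi_linear : linear phi.
Hypothesis phi_anti : forall a b, phi (a * b) = phi b * phi a.
Hypothesis phi_invol : forall a, phi (phi a) = a.
Hypothesis phi_e : forall s, phi (e s) = e s.
Hypothesis phi_dbr : forall a b, tmap phi (dbr a b) = tswap (dbr (phi a) (phi b)).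
Hypothesis alpha_even : forall s, ~~ odd (alpha s).

Lemma symplectic_poisson_structure :
  exists (br : Q -> Q -> Q) (act inf : 'M[K]_N -> Q -> Q),
    [/\ unique (fun br' => antisymmetric_biderivation br' /\
                           phi_Sp_formula dbr br') br,
        poisson_bracket br,
        is_Sp_action act /\
        (forall g, Sp_group g ->
           forall x y, act g (br x y) = br (act g x) (act g y)),
        is_infinitesimal_action inf
      & forall mu, is_double_moment_map e dbr mu -> mu + phi mu = 0 ->
          sp_algebra (XQ mu) /\
          is_moment_map br act inf (trace_pairing (XQ mu))].
Proof.
have [dB dJ] := dbr_poisson.
have [th thC thX] := rep_involution phi_linear phi_anti phi_e alpha_even.
have [sbr [sr sl] sX] := standard_bracket alpha dB.
have [br brP brE] := symrep_bracket phi_linear phi_invol alpha_even thC thX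
  dB dJ phi_dbr sr sl sX two_neq0.
have brF := symrep_bracket_formula alpha_even thX sl sX brE.
have ACT g gS := @symrep_action _ _ _ _ _ _ phi_invol alpha_even th thC thX
  dbr sbr sr sl sX br brE g gS.
have INF xi xiS := @symrep_infinitesimal _ _ _ _ _ _ phi_invol alpha_even th thC thX
  xi xiS.
(* The actions must be total in the matrix: outside the group and the Lie algebra they take the
   default values identity and zero. *)
pose act (g : 'M[K]_N) (x : Q) : Q :=
  if pselect (Sp_group g) is left gS then s2val (ACT g gS) x else x.
pose inf (xi : 'M[K]_N) (x : Q) : Q :=
  if pselect (sp_algebra xi) is left xiS then s2val (INF xi xiS) x else 0.
have actP g : Sp_group g -> exists F : {rmorphism Q -> Q},
    [/\ act g = F, forall k, F (qcst k) = qcst k,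
        forall p q, F (br p q) = br (F p) (F q)
      & forall a, map_mx F (XQ a) = qmx (sp_star g) *m XQ a *m qmx g].
  rewrite /act; case: pselect => // gS _.
  by case: (ACT g gS) => F [FC Fbr] FX; exists F; split.
exists br, act, inf; split=> //.
- split; first by split=> //; case: brP.
  move=> br' [br'D br'F]; apply: antisymmetric_biderivation_ext => //.
    by case: brP.
  by move=> a i j b k l; rewrite brF br'F.
- split=> [|g gS x y]; last by have [F [-> _ Fbr _]] := actP g gS; exact: Fbr.
  split=> [g gS|x|g h gS hS x|g gS a].
  + have [F [-> FC _ _]] := actP g gS; split.
      by move=> c x y; rewrite !symrep_scaleE rmorphD rmorphM FC.
    by split=> [|x y]; rewrite ?rmorph1 ?rmorphM.
  + have [F [-> FC _ FX]] := actP _ (@Sp_group1 K n alpha).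
    apply: (symrep_rmorphism_ext (f := F) (g := idfun)) => [k|a]; first by rewrite FC.
    rewrite FX -(Sp_group_inv alpha_even (@Sp_group1 K n alpha)) invmx1.
    rewrite qmx1 mul1mx mulmx1.
    by apply/matrixP => i j; rewrite [RHS]mxE.
  + have [F [-> FC _ FX]] := actP _ (Sp_groupM gS hS).
    have [G [-> GC _ GX]] := actP _ gS; have [H [-> HC _ HX]] := actP _ hS.
    apply: (symrep_rmorphism_ext (f := F) (g := G \o H)) => [k|a] /=.
      by rewrite FC HC GC.
    rewrite [RHS]map_mx_comp HX [RHS]map_mxM [X in _ = X *m _]map_mxM.
    rewrite !(map_qmx _ GC) GX FX sp_starM // !qmxM.
    by rewrite !mulmxA.
  + by have [F [-> _ _ FX]] := actP g gS; rewrite FX Sp_group_inv.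
- move=> xi xiS; rewrite /inf; case: pselect => // xiS'.
  by case: (INF xi xiS') => D [DD DE] DX.
move=> mu muM muphi; split.
  exact: (moment_sp_algebra muM phi_invol alpha_even thC thX muphi).
split=> [c xi zeta _ _|g xi gS xiS|xi xiS f].
- by rewrite /trace_pairing qmxP mulmxDr -scalemxAr mxtraceD mxtraceZ symrep_scaleE.
- have [F [-> FC _ FX]] := actP g gS.
  (* Coadjoint equivariance is cyclicity of the trace: the factor [sp_star g], which is the inverse
     of [g], moves from the front to the end. *)
  rewrite /trace_pairing -trace_map_mx map_mxM FX (map_qmx _ FC).
  rewrite Sp_group_inv // !qmxM -[in LHS]mulmxA -[in LHS]mulmxA [LHS]mxtrace_mulC.
  by rewrite !mulmxA.
have [_ xd] := (sp_algebraP alpha_even xi).1 xiS.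
(* A lift of the infinitesimal action to Rep(A, alpha); [D'E] identifies its class with [inf xi]. *)
have [D DD DX] := rep_infinitesimal e xd.
have [x ->] := ring_proj_surj f.
rewrite (symrep_bracket_moment dB muM alpha_even thC thX sr sl sX
  muphi two_neq0 brE xiS DD DX).
rewrite /inf; case: pselect => // xiS'.
by case: (INF xi xiS') => D' [D'D D'E] D'X /=; rewrite (D'E D).
Qed.

End SymplecticPoissonStructure.

Theorem theorem3p7 (R : realType) (A : algType R[i]) (n : nat) (e : 'I_n -> A)
    (dbr : A -> A -> tensor A A) (phi : A -> A) (alpha : 'I_n -> nat)
    (A_fg : finitely_generated A)
    (e_idem : orthogonal_idempotents e)
    (dbr_poisson : double_poisson e dbr)
    (phi_linear : linear phi)
    (phi_anti : forall a b, phi (a * b) = phi b * phi a)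
    (phi_invol : forall a, phi (phi a) = a)
    (phi_e : forall s, phi (e s) = e s)
    (phi_dbr : forall a b, tmap phi (dbr a b) = tswap (dbr (phi a) (phi b)))
    (alpha_even : forall s, ~~ odd (alpha s)) :
  exists (br : symrep_ring e alpha phi -> symrep_ring e alpha phi ->
               symrep_ring e alpha phi)
         (act inf : 'M[R[i]]_(\sum_s alpha s) ->
                    symrep_ring e alpha phi -> symrep_ring e alpha phi),
    [/\ unique (fun br' => antisymmetric_biderivation br' /\
                           phi_Sp_formula dbr br') br,
        poisson_bracket br,
        is_Sp_action act /\
        (forall g, Sp_group g ->
           forall x y, act g (br x y) = br (act g x) (act g y)),
        is_infinitesimal_action inf
      & forall mu, is_double_moment_map e dbr mu -> mu + phi mu = 0 ->
          sp_algebra (mx_coord e alpha phi mu) /\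
          is_moment_map br act inf
            (trace_pairing (mx_coord e alpha phi mu))].
Proof.
apply: (symplectic_poisson_structure _ dbr_poisson phi_linear phi_anti phi_invol
  phi_e phi_dbr alpha_even).
by rewrite Num.Theory.pnatr_eq0.
Qed.
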